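(* Let $G$ be a torsion-free group and let $C$ be a finite subset of $G$ containing the identity element such that $|C|=3$ and the subgroup $\langle C\rangle$ is not abelian. Then for all subsets $B$ of $G$ with $|B|\geq 7$, $|BC|\geq |B|+5$. Moreover, if $\langle C\rangle$ is not isomorphic to the Klein bottle group, then for all subsets $B$ of $G$ with $|B|\geq 5$, $|BC|\geq |B|+5$.
   Context: $|\cdot|$ denotes the cardinality of a finite set, so $B$ ranges over finite subsets of $G$. For subsets $B,C$ of a group $G$ (written multiplicatively), $BC=\{bc \mid b\in B,\ c\in C\}$. The Klein bottle group is the group with presentation $\langle x,y \mid xyx=y\rangle$. *)

(* Defs.v *)
From HB Require Import structures.
From mathcomp Require Import all_boot finmap.
From mathcomp Require Import boolp classical_sets functions.

Set Implicit Arguments.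
Unset Strict Implicit.
Unset Printing Implicit Defensive.

Local Open Scope classical_set_scope.
Local Open Scope group_scope.

Definition torsion_free (G : groupType) : Prop :=
  forall (x : G) (n : nat), (0 < n)%N -> x ^+ n = 1 -> x = 1.

Definition subgroup_set (G : groupType) (H : set G) : Prop :=
  group_closed (mem H).

Definition generated (G : groupType) (C : set G) : set G :=
  smallest (@subgroup_set G) C.

Definition abelian_set (G : groupType) (H : set G) : Prop :=
  {in H &, forall x y : G, commute x y}.

Definition fset_mulg (G : groupType) (B C : {fset G}) : {fset G} :=
  [fset b * c | b in B, c in C]%fset.

(* The presented group < X | R > is the quotient of the words in the letters
   x and x^-1 (x in X) by the least monoid congruence that contains R and
   cancels adjacent inverse letters. The letter (x, true) stands for x and
   (x, false) for x^-1. *)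
Section Presentation.
Variables (X : choiceType) (R : set (seq (X * bool) * seq (X * bool))).

Inductive pres_cong : seq (X * bool) -> seq (X * bool) -> Prop :=
| pres_cong_refl u : pres_cong u u
| pres_cong_sym u v : pres_cong u v -> pres_cong v u
| pres_cong_trans u v w : pres_cong u v -> pres_cong v w -> pres_cong u w
| pres_cong_cat u u' v v' :
    pres_cong u u' -> pres_cong v v' -> pres_cong (u ++ v) (u' ++ v')
| pres_cong_cancel x b : pres_cong [:: (x, b); (x, ~~ b)] [::]
| pres_cong_rel u v : R (u, v) -> pres_cong u v.

Definition pres_rel u v : bool := `[< pres_cong u v >].

Lemma pres_rel_equiv : equiv_class_of pres_rel.
Proof.
split=> [u|u v|v u w].
- exact/asboolP/pres_cong_refl.
- by apply/asboolP/asboolP; exact: pres_cong_sym.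
- by move=> /asboolP uv /asboolP vw; apply/asboolP/(pres_cong_trans uv vw).
Qed.

Canonical pres_equiv := EquivRelPack pres_rel_equiv.

Definition presented := {eq_quot pres_equiv}%qT.

HB.instance Definition _ := Choice.on presented.
HB.instance Definition _ := Quotient.on presented.

Definition pres_pi (u : seq (X * bool)) : presented := (\pi_presented u)%qT.

Lemma pres_piP u v : pres_pi u = pres_pi v <-> pres_cong u v.
Proof.
split=> [/eqmodP/asboolP //|uv]; apply/eqmodP; exact/asboolP.
Qed.

Lemma pres_repr (a : presented) : pres_pi (repr a) = a.
Proof. exact: reprK. Qed.

Definition word_inv (u : seq (X * bool)) : seq (X * bool) :=
  rev [seq (p.1, ~~ p.2) | p <- u].

Lemma word_invK : involutive word_inv.
Proof.
move=> u; rewrite /word_inv map_rev revK -map_comp -[RHS]map_id.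
by apply: eq_map => -[x b] /=; rewrite negbK.
Qed.

Lemma word_invV u : pres_cong (u ++ word_inv u) [::].
Proof.
elim: u => [|[x b] u IH]; first exact: pres_cong_refl.
rewrite /word_inv /= rev_cons -cats1 catA -cat1s -[X in pres_cong X]cats0.
rewrite -!catA cats0; apply: pres_cong_trans (pres_cong_cancel x b).
rewrite -[[:: (x, b); _]]cat1s; apply: pres_cong_cat (pres_cong_refl _) _.
rewrite catA -[[:: (x, ~~ b)] in X in pres_cong _ X]cat0s.
exact: pres_cong_cat IH (pres_cong_refl _).
Qed.

Lemma word_invVl u : pres_cong (word_inv u ++ u) [::].
Proof. by rewrite -{2}[u]word_invK; exact: word_invV. Qed.

Lemma word_inv_cong u v :
  pres_cong u v -> pres_cong (word_inv u) (word_inv v).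
Proof.
move=> uv; apply: (@pres_cong_trans _ (word_inv u ++ (v ++ word_inv v))).
  rewrite -[X in pres_cong X]cats0; apply: pres_cong_cat (pres_cong_refl _) _.
  exact/pres_cong_sym/word_invV.
rewrite catA -[X in pres_cong _ X]cat0s.
apply: pres_cong_cat (pres_cong_refl _).
apply: pres_cong_trans (word_invVl u).
exact: pres_cong_cat (pres_cong_refl _) (pres_cong_sym uv).
Qed.

Definition pres_one : presented := pres_pi [::].
Definition pres_mul (a b : presented) : presented := pres_pi (repr a ++ repr b).
Definition pres_inv (a : presented) : presented := pres_pi (word_inv (repr a)).

Lemma pres_repr_cong u : pres_cong (repr (pres_pi u)) u.
Proof. by apply/pres_piP; exact: pres_repr. Qed.

Lemma pres_mulE u v : pres_mul (pres_pi u) (pres_pi v) = pres_pi (u ++ v).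
Proof. by apply/pres_piP/pres_cong_cat; exact: pres_repr_cong. Qed.

Lemma pres_invE u : pres_inv (pres_pi u) = pres_pi (word_inv u).
Proof. exact/pres_piP/word_inv_cong/pres_repr_cong. Qed.

Lemma pres_mulA : associative pres_mul.
Proof.
move=> a b c; rewrite -(pres_repr a) -(pres_repr b) -(pres_repr c).
by rewrite !pres_mulE catA.
Qed.

Lemma pres_mul1 : left_id pres_one pres_mul.
Proof. by move=> a; rewrite -(pres_repr a) pres_mulE. Qed.

Lemma pres_mulr1 : right_id pres_one pres_mul.
Proof. by move=> a; rewrite -(pres_repr a) pres_mulE cats0. Qed.

Lemma pres_mulV : left_inverse pres_one pres_inv pres_mul.
Proof.
move=> a; rewrite -(pres_repr a) pres_invE pres_mulE.
exact/pres_piP/word_invVl.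
Qed.

Lemma pres_mulrV : right_inverse pres_one pres_inv pres_mul.
Proof.
move=> a; rewrite -(pres_repr a) pres_invE pres_mulE.
exact/pres_piP/word_invV.
Qed.

HB.instance Definition _ := isGroup.Build presented
  pres_mulA pres_mul1 pres_mulr1 pres_mulV pres_mulrV.

End Presentation.

(* < x, y | xyx = y > with x encoded by true and y by false. *)
Definition klein_rel : set (seq (bool * bool) * seq (bool * bool)) :=
  let x := (true, true) in let y := (false, true) in
  [set ([:: x; y; x], [:: y])].

Definition klein_bottle_group : groupType := presented klein_rel.

Definition subgroup_isog (K G : groupType) (H : set G) : Prop :=
  exists f : {multiplicative K -> G}, set_bij [set: K] H f.

(* Main.v *)
(* Write f(X) = |XC| - |X| and C = {c_0, c_1, c_2}. Two elements a, b of G are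
   adjacent when the cosets aC and bC meet; a cycle of adjacencies spells out an
   alternating relator c_i c_j^-1 c_k c_l^-1 ... = 1.

   An alternating relator of length at most 6 makes G contain torsion, makes <C>
   abelian, or says that u v u = v for u = c_i c_j^-1 and v = c_k c_j^-1. In the
   last case <C> is the Klein bottle group and, C c_j^-1 being {1, u, v}, the
   bound for |B| >= 7 follows from counting along the cosets b <u>, which right
   multiplication by v permutes without finite cycles.

   If there is no such relator, three pairwise adjacent elements lie on a common
   point. A set of 5 elements with f < 5 would then contain a complete bipartite
   graph K_{2,3} of adjacencies, which gives two relators of length 8; these
   cases are refuted by computation. For larger sets use Hamidoune's atoms:
   f is submodular and invariant under left translation, so a smallest minimizer
   B of f among the sets with at least 5 elements meets each of its translates
   gB, g <> 1, in at most 4 elements. Every point of BC is covered at least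
   twice, so each b in B gets a fixed-point-free map t of {0, 1, 2} such that
   b c_i c_(t i)^-1 is in B for all i, and distinct elements of B get distinct
   maps. There are only 8 such maps; this forces |B| = 8, each map occurring
   once, and the resulting adjacency graphs are refuted by computation. *)
Require Import Defs.
From HB Require Import structures.
From mathcomp Require Import all_boot finmap.
From mathcomp Require Import boolp classical_sets functions.
From mathcomp Require Import zify.

Set Implicit Arguments.
Unset Strict Implicit.
Unset Printing Implicit Defensive.

(** * Consequences of group relators *)

Section Eval.
Local Open Scope group_scope.
Variables (T : choiceType) (G : groupType) (c : T -> G).
Implicit Types (u v w : seq (T * bool)) (l : T * bool).

Definition eval_letter l : G := if l.2 then c l.1 else (c l.1)^-1.

Definition eval w : G := foldr (fun l g => eval_letter l * g) 1 w.

Lemma eval_cat u v : eval (u ++ v) = eval u * eval v.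
Proof. by elim: u => [|l u IH] /=; rewrite ?mul1g // IH mulgA. Qed.

Lemma eval_letterV l : eval_letter (l.1, ~~ l.2) = (eval_letter l)^-1.
Proof. by case: l => x [] //=; rewrite /eval_letter /= invgK. Qed.

Lemma eval_inv w : eval (word_inv w) = (eval w)^-1.
Proof.
elim: w => [|l w IH] /=; first by rewrite invg1.
rewrite /word_inv /= rev_cons -cats1 eval_cat -/(word_inv w) IH /= mulg1.
by rewrite eval_letterV invgM.
Qed.

Lemma eval_cat_eq1C u v : eval (u ++ v) = 1 -> eval (v ++ u) = 1.
Proof.
rewrite !eval_cat => uv; apply: (mulgI (eval u)).
by rewrite mulgA uv mul1g mulg1.
Qed.

Lemma eval_rot_eq1 n w : eval w = 1 -> eval (rot n w) = 1.
Proof. by rewrite -{1}(cat_take_drop n w) => /eval_cat_eq1C. Qed.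

Lemma eval_nseq n w : eval (flatten (nseq n w)) = eval w ^+ n.
Proof. by elim: n => [|n IH] //=; rewrite eval_cat IH expgS. Qed.

End Eval.

(* A relator is a word in the letters c_i = (i, true) and c_i^-1 = (i, false)
   that evaluates to 1. [saturate] looks for a relator satisfying [kill] among
   the short consequences of given relators, obtained by multiplying conjugates
   of relators and, G being torsion free, by taking roots. *)
Section Saturation.
Implicit Types (u v w r s : seq (nat * bool)) (a b : nat * bool).

Definition cancels a b : bool := (a.1 == b.1) && (a.2 != b.2).

Definition free_cons a w :=
  if w is b :: w' then if cancels a b then w' else a :: w else [:: a].

Definition free_red w := foldr free_cons [::] w.

Fixpoint cyc_red_rec n w :=
  if n isn't n'.+1 then w else
  if w isn't a :: v then w else
  if cancels (last a v) a then cyc_red_rec n' (free_red (rcons v a)) else w.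

Definition cyc_red w := let u := free_red w in cyc_red_rec (size u) u.

(** Periods are tried in increasing order, so this is the primitive root. Taking it is where
    torsion-freeness helps: u^n = 1 gives u = 1. *)
Definition root w :=
  let n := size w in
  let periodic d :=
    if rot d w == w then w == flatten (nseq (n %/ d) (take d w)) else false in
  if [seq d <- iota 1 n.-1 | periodic d] is d :: _ then take d w else w.

Definition rots w := [seq rot i w | i <- iota 0 (size w)].

Definition conj_rots w := rots w ++ rots (word_inv w).

Definition joins u v :=
  if (u, v) is (a :: u', b :: _) then cancels (last a u') b else false.

(* The length bound 12 and the fuel 20 in [refute] suffice for all refutations
   below. Conditionals are written with [if], since [vm_compute] evaluates both
   arguments of [&&], [||] and [==>]. *)
Definition products r s :=
  let vs := conj_rots s in
  let ws := [seq cyc_red (u ++ v) | u <- rots r, v <- [seq v <- vs | joins u v]] in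
  [seq root w | w <- ws & 0 < size w <= 12].

(* [known] lists the rotations of the words seen so far and of their inverses. *)
Fixpoint enqueue (ws todo known : seq (seq (nat * bool))) :=
  if ws isn't w :: ws' then (todo, known) else
  if w \notin known then
    enqueue ws' (merge (relpre size leq) [:: w] todo) (conj_rots w ++ known)
  else enqueue ws' todo known.

Variable kill : pred (seq (nat * bool)).

(** The queue is sorted by length: the shortest pending relator is multiplied with itself and with
    all those processed before. *)
Fixpoint saturate n (seen todo known : seq (seq (nat * bool))) : bool :=
  if n isn't n'.+1 then false else
  if todo isn't r :: todo' then false else
  let ws := flatten [seq products r s | s <- r :: seen] in
  if has kill ws then true else
  let: (todo'', known') := enqueue ws todo' known in
  saturate n' (r :: seen) todo'' known'.

Definition refute (rs : seq (seq (nat * bool))) :=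
  let ws := [seq root w | w <- [seq cyc_red r | r <- rs] & 0 < size w] in
  if has kill ws then true else
  let: (todo, known) := enqueue ws [::] [::] in saturate 20 [::] todo known.


Variables (G : groupType) (c : nat -> G).
Hypothesis tfG : torsion_free G.
Notation relator w := (eval c w = 1%g).

Lemma eval_free_cons a w :
  eval c (free_cons a w) = (eval_letter c a * eval c w)%g.
Proof.
case: w => [|b w] //=; case: ifP => // /andP[/eqP ab1 ab2].
rewrite mulgA (_ : eval_letter c a * eval_letter c b = 1)%g ?mul1g //.
case: a b ab1 ab2 => [i x] [j y] /= <- xy.
rewrite -[RHS](mulgV (c i)) /eval_letter /=.
by case: x y xy => [] [] //=; rewrite mulVg mulgV.
Qed.

Lemma eval_free_red w : eval c (free_red w) = eval c w.
Proof. by elim: w => //= a w IH; rewrite eval_free_cons IH. Qed.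

Lemma relator_cyc_red w : relator w -> relator (cyc_red w).
Proof.
rewrite -eval_free_red /cyc_red; set u := free_red w; move: (size u) => n.
elim: n u => [|n IH] // [|a v] // av; rewrite [cyc_red_rec _ _]/=.
case: ifP => // _; apply: IH; rewrite eval_free_red -cats1.
exact: (@eval_cat_eq1C _ _ c [:: a]).
Qed.

Lemma relator_root w : relator w -> relator (root w).
Proof.
rewrite /root; set s := [seq d <- _ | _]; move=> w1.
have : {subset s <= [pred d |
    (0 < d) && (w == flatten (nseq (size w %/ d) (take d w)))]}.
  move=> d; rewrite mem_filter mem_iota inE => /andP[+ /andP[-> _]].
  by case: ifP.
case: s => // d s /(_ d); rewrite inE eqxx => /(_ isT) /andP[d0 /eqP wE].
have [wd|wd] := posnP (size w %/ d).
  by move: wE; rewrite wd /= => ->.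
by apply: (tfG wd); rewrite -eval_nseq -wE.
Qed.

Lemma relator_conj_rots w u : u \in conj_rots w -> relator w -> relator u.
Proof.
rewrite mem_cat => /orP[] /mapP[i _ ->] w1; apply: eval_rot_eq1 => //.
by rewrite eval_inv w1 invg1.
Qed.

Lemma relator_products r s u :
  u \in products r s -> relator r -> relator s -> relator u.
Proof.
move=> /mapP[w + ->] r1 s1; rewrite mem_filter => /andP[_].
case/allpairsPdep=> [u1 [u2 [u1r + ->]]]; rewrite mem_filter => /andP[_ u2s].
apply/relator_root/relator_cyc_red; rewrite eval_cat (relator_conj_rots u2s) //.
case/mapP: u1r => i _ ->; rewrite mulg1; exact: eval_rot_eq1.
Qed.

Lemma mem_enqueue ws todo known :
  {subset (enqueue ws todo known).1 <= ws ++ todo}.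
Proof.
elim: ws todo known => [|w ws IH] todo known //= u; case: ifP => _ /IH.
  rewrite !(inE, mem_cat) mem_merge mem_cat inE.
  by case/or3P=> ->; rewrite ?orbT.
by rewrite !(inE, mem_cat) => /orP[->|->]; rewrite !orbT.
Qed.

Hypothesis killN : forall w, kill w -> eval c w <> 1%g.

Lemma saturateN n seen todo known :
  {in seen ++ todo, forall w, relator w} -> ~~ saturate n seen todo known.
Proof.
elim: n seen todo known => [|n IH] seen [|r todo] known //= rel.
have r1 : relator r by apply: rel; rewrite mem_cat mem_head orbT.
have seen1 w : w \in r :: seen -> relator w.
  by rewrite inE => /predU1P[->//|wS]; apply: rel; rewrite mem_cat wS.
set ws := _ ++ flatten _.
have ws1 w : w \in ws -> relator w.
  rewrite mem_cat => /orP[wP|/flatten_mapP[s sS wP]].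
    exact: (relator_products wP r1).
  by apply: relator_products wP r1 (seen1 _ _); rewrite inE sS orbT.
case: ifPn => [/hasP[w wS kw]|_]; first by case: (killN kw); exact: ws1.
case: enqueue (@mem_enqueue ws todo known) => todo' known' /= sub.
apply: IH => w; rewrite mem_cat => /orP[/seen1//|/sub].
rewrite mem_cat => /orP[/ws1//|wT].
by apply: rel; rewrite mem_cat inE wT !orbT.
Qed.

(** Soundness: the search only produces consequences of [rs], and [killN] excludes the relators it
    looks for. *)
Lemma refuteN rs : {in rs, forall w, relator w} -> ~~ refute rs.
Proof.
move=> rel; rewrite /refute; set ws := [seq root w | w <- _].
have ws1 w : w \in ws -> relator w.
  case/mapP=> u + ->; rewrite mem_filter => /andP[_ /mapP[r rR ->]].
  by apply/relator_root/relator_cyc_red/rel.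
case: ifPn => [/hasP[w wS kw]|_]; first by case: (killN kw); exact: ws1.
case: enqueue (@mem_enqueue ws [::] [::]) => todo known sub.
apply: (@saturateN 20 [::] todo known) => w /sub.
by rewrite cats0 => /ws1.
Qed.

End Saturation.

(** * Short alternating words and theta graphs *)

Definition alternates (a b : nat * bool) : bool := (a.1 != b.1) && (a.2 != b.2).

(** The cyclic word c_i c_j^-1 c_k c_l^-1 ... is a closed chain of cosets: i != j says that
    consecutive cosets differ, j != k that consecutive common points do. *)
Definition short_alt (w : seq (nat * bool)) : bool :=
  [&& 0 < size w <= 6, all (fun l => l.1 < 3) w & cycle alternates w].

Definition triples : seq (seq nat) :=
  [seq i :: s
    | i <- iota 0 3, s <- [seq [:: j; k] | j <- iota 0 3, k <- iota 0 3]].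

(** The value p^-1 q along the path p, x, q when p c_i = x c_(a i) and x c_(b i) = q c_(d i). Three
    such paths form a theta graph. *)
Definition theta_word (a b d : seq nat) i :=
  [:: (i, true); (nth 0 a i, false); (nth 0 b i, true); (nth 0 d i, false)].

Definition theta_rels (a b d : seq nat) :=
  [seq theta_word a b d p.1 ++ word_inv (theta_word a b d p.2)
    | p <- [:: (0, 1); (0, 2); (1, 2)]].

Definition theta_valid (a b d : seq nat) : bool :=
  uniq d && all (fun i => [&& nth 0 a i != i, nth 0 b i != nth 0 a i
                            & nth 0 d i != nth 0 b i]) (iota 0 3).

Lemma theta_refuted : all (fun a => all (fun b => all (fun d =>
  if theta_valid a b d then refute short_alt (theta_rels a b d) else true)
  triples) triples) triples.
Proof. by vm_compute. Qed.

Lemma mem_triples i j k :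
  i < 3 -> j < 3 -> k < 3 -> [:: i; j; k] \in triples.
Proof. by case: i j k => [|[|[|]]] // [|[|[|]]] // [|[|[|]]]. Qed.

(* An edge (x, y, (i, j)) records that x c_i = y c_j; [walks E n x y] lists the
   words x^-1 y spelled out by the walks of length [n] from [x] to [y]. *)
Section Walks.
Variable V : eqType.
Implicit Types (E : seq (V * V * (nat * nat))) (x y : V).

Fixpoint walks E n x y : seq (seq (nat * bool)) :=
  if n isn't n'.+1 then if x == y then [:: [::]] else [::]
  else flatten [seq [seq (e.2.1, true) :: (e.2.2, false) :: w
                      | w <- walks E n' e.1.2 y] | e <- E & e.1.1 == x].

Definition flip (e : V * V * (nat * nat)) := (e.1.2, e.1.1, (e.2.2, e.2.1)).

Variables (G : groupType) (c : nat -> G) (f : V -> G).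

Definition realizes E :=
  {in E, forall e, f e.1.1 * c e.2.1 = f e.1.2 * c e.2.2}%g.

Lemma eval_walks E n x y w : realizes E -> w \in walks E n x y ->
  eval c w = ((f x)^-1 * f y)%g.
Proof.
move=> fE; elim: n x w => [|n IH] x w /=.
  by case: eqP => [->|//]; rewrite inE => /eqP->; rewrite mulVg.
case/flatten_mapP=> e; rewrite mem_filter => /andP[/eqP <- /fE e1].
case/mapP=> u /IH uE -> /=; rewrite uE /eval_letter /=.
by apply: (mulgI (f e.1.1)); rewrite mulVKg !mulgA e1 mulgK mulgV mul1g.
Qed.

Lemma realizes_flip E : realizes E -> realizes (map flip E).
Proof. by move=> fE _ /mapP[e /fE eE ->]; rewrite /= eE. Qed.

Lemma realizes_cat E E' : realizes E -> realizes E' -> realizes (E ++ E').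
Proof. by move=> fE fE' e; rewrite mem_cat => /orP[/fE|/fE']. Qed.

End Walks.

(* The code [t] stands for the function i |-> nxt t i on {0, 1, 2}; these are
   the eight functions without fixed points. *)
Definition code : Type := bool * bool * bool.

Definition nxt (t : code) (i : nat) : nat :=
  (i + (if nth false [:: t.1.1; t.1.2; t.2] i then 1 else 2)) %% 3.

Definition codes : seq code :=
  let bs := [:: true; false] in
  [seq (p, e) | p <- [seq (a, b) | a <- bs, b <- bs], e <- bs].

Lemma mem_codes (t : code) : t \in codes.
Proof. by case: t => [[[] []] []]. Qed.

Lemma nxt_lt3 t i : nxt t i < 3.
Proof. exact: ltn_pmod. Qed.

Lemma nxt_neq t i : i < 3 -> nxt t i != i.
Proof. by case: t => [[[] []] []]; case: i => [|[|[|]]]. Qed.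

Lemma nxt_update t i j : i < 3 -> j < 3 -> j != i ->
  exists2 t', nxt t' i = j & forall k, k < 3 -> k != i -> nxt t' k = nxt t k.
Proof.
case: t => [[a b] d] i3 j3 ji; pose e := j == (i + 1) %% 3.
exists (if i == 0 then e else a, if i == 1 then e else b,
        if i == 2 then e else d).
  by rewrite /e {e}; case: i j i3 j3 ji => [|[|[|]]] // [|[|[|]]].
by move: (e) => {ji} {}e k; case: i k i3 => [|[|[|]]] // [|[|[|]]].
Qed.

Lemma nxt_code i j k : i < 3 -> j < 3 -> k < 3 -> i != 0 -> j != 1 -> k != 2 ->
  exists t, [/\ nxt t 0 = i, nxt t 1 = j & nxt t 2 = k].
Proof.
move=> i3 j3 k3 i0 j1 k2; exists (i == 1, j == 2, k == 0).
split.
- by case: i i3 i0 => [|[|[|]]].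
- by case: j j3 j1 => [|[|[|]]].
- by case: k k3 k2 => [|[|[|]]].
Qed.

Definition codes_to i j : seq code := [seq t <- codes | nxt t i == j].

(** For an atom with one element g t per code t, sending t to the code of (g t) c_i c_j^-1 is such a
    bijection from [codes_to i j] to [codes_to j i]; it has no fixed point since i != j. *)
Definition matchings i j : seq (seq code) :=
  [seq p <- permutations (codes_to j i)
    | all (fun q => q.1 != q.2) (zip (codes_to i j) p)].

Definition edges i j (p : seq code) : seq (code * code * (nat * nat)) :=
  let E := [seq (q, (i, j)) | q <- zip (codes_to i j) p] in
  E ++ map (@flip _) E.

Definition closed_walks E n : seq (seq (nat * bool)) :=
  flatten [seq walks E n t t | t : code <- codes].

Definition short_cycle E : bool :=
  has (fun w => short_alt (cyc_red w)) (closed_walks E 2 ++ closed_walks E 3).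

(** Pairs of matchings with a short alternating cycle are discarded before a third is tried. Triples
    without one are refuted from their closed walks of four edges, relators of length 8. *)
Lemma matchings_refuted :
  all (fun p => all (fun q => let E := edges 0 1 p ++ edges 0 2 q in
    if short_cycle E then true else
    all (fun r => let E' := E ++ edges 1 2 r in
      if short_cycle E' then true else refute short_alt (closed_walks E' 4))
    (matchings 1 2)) (matchings 0 2)) (matchings 0 1).
Proof. by vm_compute. Qed.

Lemma no_matchings (G : groupType) (c : nat -> G) (f : code -> G) p q r :
  torsion_free G -> (forall w, short_alt w -> eval c w <> 1%g) ->
  p \in matchings 0 1 -> q \in matchings 0 2 -> r \in matchings 1 2 ->
  realizes c f (edges 0 1 p) -> realizes c f (edges 0 2 q) ->
  realizes c f (edges 1 2 r) -> False.
Proof.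
move=> tfG altN pM qM rM pE qE rE.
have rel E n : realizes c f E ->
    {in closed_walks E n, forall w, eval c w = 1%g}.
  by move=> fE w /flatten_mapP[t _ /(eval_walks fE)->]; rewrite mulVg.
have short E : realizes c f E -> ~~ short_cycle E.
  move=> fE; apply/hasPn => w wE; apply/negP => /altN; apply.
  by apply: relator_cyc_red; move: wE; rewrite mem_cat => /orP[]; apply: rel.
have H := elimT allP (elimT allP matchings_refuted p pM) q qM.
have pqE := realizes_cat pE qE; have E' := realizes_cat pqE rE.
move: H; cbv beta zeta; rewrite (negbTE (short _ pqE)) => H.
move: (elimT allP H r rM); cbv beta zeta; rewrite (negbTE (short _ E')).
apply/negP.
exact: (refuteN tfG altN (rel _ 4 E')).
Qed.

(** * Sets C without short alternating relators *)

Section Geometry.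
Local Open Scope group_scope.
Variables (G : groupType) (c : nat -> G) (C : {fset G}).
Hypothesis tfG : torsion_free G.
Hypothesis CE : C =i [:: c 0%N; c 1%N; c 2%N].
Hypothesis altN : forall w, short_alt w -> eval c w <> 1.

Definition incident (a v : G) : bool := a^-1 * v \in C.

Lemma incidentP a v :
  reflect (exists2 i, (i < 3)%N & v = a * c i) (incident a v).
Proof.
rewrite /incident CE !inE; apply: (iffP or3P).
  by case=> /eqP vE; [exists 0%N|exists 1%N|exists 2%N]; rewrite -?vE ?mulVKg.
by case=> -[|[|[|]]] // _ ->; rewrite mulKg eqxx; constructor.
Qed.

Lemma c_inj i j : (i < 3)%N -> (j < 3)%N -> c i = c j -> i = j.
Proof.
move=> i3 j3 cij; apply/eqP/negP => /negP ij.
have /altN[] : short_alt [:: (i, true); (j, false)].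
  by rewrite /short_alt /= /alternates /= i3 j3 ij eq_sym ij.
by rewrite /= /eval_letter /= cij mulg1 mulgV.
Qed.

Lemma card_C : #|` C| = 3.
Proof.
rewrite (_ : C = [fset x in [:: c 0%N; c 1%N; c 2%N]]%fset); last first.
  by apply/fsetP=> x; rewrite CE in_fset.
rewrite card_fseq undup_id //= !inE negb_or.
by apply/and3P; split=> //; [apply/andP; split|];
  apply/eqP => /c_inj-/(_ isT isT).
Qed.

(** Two common points of distinct cosets would spell an alternating relator of length 4. *)
Lemma incident_inj a b v w : a != b ->
  incident a v -> incident b v -> incident a w -> incident b w -> v = w.
Proof.
move=> ab /incidentP[i i3 ->] /incidentP[j j3 ij] /incidentP[k k3 ->].
move=> /incidentP[l l3 kl]; congr (_ * c _); apply/eqP/negP => /negP ik.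
have neq p q : (a * c p = b * c q)%g -> p != q.
  by move=> pq; apply: contraNneq ab => pqE; move: pq; rewrite pqE => /mulIg->.
have ij' := neq _ _ ij; have kl' := neq _ _ kl.
have jl : j != l.
  apply: contraNneq ik => jl; apply/eqP/c_inj => //; apply: (mulgI a).
  by rewrite ij kl jl.
have /altN[] : short_alt [:: (i, true); (j, false); (l, true); (k, false)].
  rewrite /short_alt /= /alternates /= i3 j3 k3 l3 ij' jl (eq_sym l) kl'.
  by rewrite (eq_sym k) ik.
rewrite /= /eval_letter /= mulg1; apply: (mulgI a); rewrite mulg1.
by rewrite !mulgA ij mulgK -kl mulgK.
Qed.

Definition adjacent (a b : G) : Prop :=
  a != b /\ exists2 v, incident a v & incident b v.

Lemma adjacent_sym a b : adjacent a b -> adjacent b a.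
Proof. by case=> ab [v av bv]; split; [rewrite eq_sym|exists v]. Qed.

(** Otherwise the three common points are pairwise distinct and the triangle spells an alternating
    relator of length 6. *)
Lemma adjacent_triangle a b d : adjacent a b -> adjacent b d -> adjacent d a ->
  exists v, [/\ incident a v, incident b v & incident d v].
Proof.
case=> ab [u au bu] [bd [v bv dv]] [da [w dw aw]].
have [uv|uv] := eqVneq u v; first by exists u; rewrite {3}uv.
have [vw|vw] := eqVneq v w; first by exists v; rewrite {1}vw.
have [wu|wu] := eqVneq w u; first by exists w; rewrite {2}wu.
move: au bu bv dv dw aw.
move=> /incidentP[i i3 ui] /incidentP[j j3 uj] /incidentP[k k3 vk].
move=> /incidentP[l l3 vl] /incidentP[m m3 wm] /incidentP[n n3 wn].
have neq (x y z : G) (p q : nat) :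
    z = x * c p -> z = y * c q -> x != y -> p != q.
  move=> -> xy; apply: contraNneq => pq; apply/eqP/(mulIg (c p)).
  by rewrite xy pq.
have neqv (x y z : G) (p q : nat) :
    y = x * c p -> z = x * c q -> y != z -> p != q.
  by move=> -> ->; apply: contraNneq => ->.
have /altN[] : short_alt [:: (i, true); (j, false); (k, true); (l, false);
                             (m, true); (n, false)].
  rewrite /short_alt /= /alternates /= i3 j3 k3 l3 m3 n3.
  rewrite (neq _ _ _ _ _ ui uj ab) (neqv _ _ _ _ _ uj vk uv).
  rewrite (neq _ _ _ _ _ vk vl bd) (neqv _ _ _ _ _ vl wm vw).
  rewrite (neq _ _ _ _ _ wm wn da).
  by rewrite (neqv _ _ _ _ _ wn ui wu).
rewrite /= /eval_letter /= mulg1; apply: (mulgI a); rewrite mulg1.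
rewrite !mulgA -ui uj mulgK -vk vl mulgK -wm.
by rewrite wn mulgK.
Qed.

(** * Numbers of points covered by few elements *)

Definition lcoset (a : G) : {fset G} := [fset a * z | z in C]%fset.

Lemma mem_lcoset a v : (v \in lcoset a) = incident a v.
Proof.
apply/imfsetP/idP => [[z zC ->]|av]; first by rewrite /incident mulKg.
by exists (a^-1 * v); rewrite ?mulVKg.
Qed.

Lemma card_lcoset a : #|` lcoset a| = 3.
Proof. by rewrite card_imfset ?card_C //; exact: mulgI. Qed.

Lemma mem_fset_mulg (B : {fset G}) v :
  (v \in fset_mulg B C) = has (incident^~ v) B.
Proof.
apply/imfset2P/hasP => [[b bB [z zC ->]]|[b bB bv]].
  by exists b => //; rewrite /incident mulKg.
by exists b => //; exists (b^-1 * v); rewrite ?mulVKg.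
Qed.

Definition seq_mul (s : seq G) : {fset G} := fset_mulg [fset x in s]%fset C.

Lemma mem_seq_mul s v : (v \in seq_mul s) = has (incident^~ v) s.
Proof. by rewrite mem_fset_mulg; apply: eq_has_r => x; rewrite in_fset. Qed.

Lemma eq_seq_mul s t : s =i t -> seq_mul s = seq_mul t.
Proof.
by move=> st; apply/fsetP=> v; rewrite !mem_seq_mul; exact: eq_has_r.
Qed.

Local Close Scope group_scope.

Definition cover (s : seq G) := #|` seq_mul s|.

Definition overlap s a := #|` lcoset a `&` seq_mul s|%fset.

Lemma cover_cons a s : cover (a :: s) + overlap s a = cover s + 3.
Proof.
rewrite /cover (_ : seq_mul (a :: s) = lcoset a `|` seq_mul s)%fset; last first.
  by apply/fsetP => v; rewrite in_fsetU mem_lcoset !mem_seq_mul.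
by rewrite cardfsUI card_lcoset addnC.
Qed.

Lemma overlap_le3 s a : overlap s a <= 3.
Proof. by rewrite -(card_lcoset a); apply/fsubset_leq_card/fsubsetIl. Qed.

(* One element of [s] for each point of [a C] that is covered by [s]; two of
   them are not adjacent, since they would form a triangle with [a]. *)
Lemma overlap_witness s a : a \notin s ->
  exists t : seq G, [/\ uniq t, size t = overlap s a, {subset t <= s},
    {in t, forall x, adjacent a x} & {in t &, forall x y, ~ adjacent x y}].
Proof.
move=> as_; set I := (lcoset a `&` seq_mul s)%fset.
pose f v := nth a s (find (incident^~ v) s).
have fP v : v \in I -> [/\ f v \in s, incident (f v) v & incident a v].
  rewrite in_fsetI mem_lcoset mem_seq_mul => /andP[av sv].
  split=> //; first by rewrite mem_nth -?has_find.
  exact: (@nth_find _ a (incident^~ v)).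
have af v : v \in I -> a != f v.
  by move=> /fP[fs _ _]; apply: contraNneq as_ => ->.
have finj : {in I &, injective f}.
  move=> v w vI wI fvw; have [_ fv av] := fP _ vI; have [_ fw aw] := fP _ wI.
  by apply: (incident_inj (af _ vI)); rewrite // fvw.
exists [seq f v | v <- I]; split.
- by rewrite map_inj_in_uniq ?fset_uniq //; exact: finj.
- by rewrite size_map.
- by move=> _ /mapP[v vI ->]; case: (fP _ vI).
- by move=> _ /mapP[v vI ->]; case: (fP _ vI); split; [exact: af|exists v].
move=> _ _ /mapP[v vI ->] /mapP[w wI ->] adj.
have [_ fv av] := fP _ vI; have [_ fw aw] := fP _ wI.
have afv : adjacent a (f v) by split; [exact: af|exists v].
have afw : adjacent (f w) a by apply: adjacent_sym; split; [exact: af|exists w].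
have [u [au vu wu]] := adjacent_triangle afv adj afw.
have uv : u = v by apply: (incident_inj (af _ vI)).
have uw : u = w by apply: (incident_inj (af _ wI)).
by case: adj; rewrite -uv -uw eqxx.
Qed.

Lemma cover_independent s : uniq s ->
  {in s &, forall x y, ~ adjacent x y} -> cover s = 3 * size s.
Proof.
elim: s => [|a s IH] /=.
  move=> _ _; apply/eqP; rewrite cardfs_eq0; apply/eqP/fsetP=> v.
  by rewrite mem_seq_mul.
move=> /andP[as_ us] ind; have := cover_cons a s.
have [t [_ tE ts at_ _]] := overlap_witness as_.
rewrite IH //; last by move=> x y xs ys; apply: ind; rewrite inE ?xs ?ys orbT.
suff -> : overlap s a = 0 by rewrite addn0 mulnS addnC.
case: t tE ts at_ => // x t _ /(_ x (mem_head _ _)) xs /(_ x (mem_head _ _)) ax.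
by case: (ind a x); rewrite ?mem_head // inE xs orbT.
Qed.

Lemma overlap_le_size s a : a \notin s -> overlap s a <= size s.
Proof. by case/overlap_witness=> t [ut <- ts _ _]; exact: uniq_leq_size. Qed.

Lemma overlap_eq_size s a : uniq s -> a \notin s -> overlap s a = size s ->
  [/\ cover s = 3 * size s, {in s, forall x, adjacent a x}
    & {in s &, forall x y, ~ adjacent x y}].
Proof.
move=> us /overlap_witness[t [ut tE ts at_ ind]] ov.
have [_ st] : (size t = size s) * (t =i s).
  by apply: uniq_min_size => //; rewrite tE ov.
have ind' : {in s &, forall x y, ~ adjacent x y}.
  by move=> x y; rewrite -!st; exact: ind.
by split=> // [|x]; [exact: cover_independent|rewrite -st; exact: at_].
Qed.

Lemma cover1 s : size s = 1 -> cover s = 3.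
Proof.
case: s => [|a []] // _; rewrite cover_independent // => x y.
by rewrite !inE => /eqP-> /eqP-> []; rewrite eqxx.
Qed.

Lemma cover2 s : uniq s -> size s = 2 -> 5 <= cover s.
Proof.
case: s => //= a s /andP[as_ us] [ss]; have := cover_cons a s.
by have := overlap_le_size as_; rewrite (cover1 ss) ss; lia.
Qed.

(** A full overlap makes [s] independent, so it already covers 3|s| points; a smaller overlap is
    handled by the previous bound. The bound for four elements follows likewise. *)
Lemma cover3 s : uniq s -> size s = 3 -> 7 <= cover s.
Proof.
case: s => //= a s /andP[as_ us] [ss]; have := cover_cons a s.
have := overlap_le_size as_; have := cover2 us ss; rewrite ss.
have [ov|] := eqVneq (overlap s a) 2; last by lia.
have [|-> _ _] := overlap_eq_size us as_; rewrite ?ss //; lia.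
Qed.

Lemma cover4 s : uniq s -> size s = 4 -> 8 <= cover s.
Proof.
case: s => //= a s /andP[as_ us] [ss]; have := cover_cons a s.
have := overlap_le_size as_; have := cover3 us ss; rewrite ss.
have [ov|] := eqVneq (overlap s a) 3; last by lia.
have [|-> _ _] := overlap_eq_size us as_; rewrite ?ss //; lia.
Qed.

Lemma incident_card v s :
  uniq s -> {in s, forall x, incident x v} -> size s <= 3.
Proof.
move=> us sv; rewrite -(size_map (fun x => x^-1 * v)%g) -card_C.
apply: uniq_leq_size; last by move=> _ /mapP[x xs ->]; exact: sv.
by rewrite map_inj_uniq // => x y /mulIg/invg_inj.
Qed.

Lemma incident4 v a b d e : uniq [:: a; b; d; e] ->
  incident a v -> incident b v -> incident d v -> incident e v -> False.
Proof.
move=> u4 av bv dv ev; suff : size [:: a; b; d; e] <= 3 by [].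
apply: (incident_card (v := v)) => // z.
by rewrite !inE => /or4P[] /eqP->.
Qed.

(** If p, x and y met in one point, the triangle q, x, y would put q on it too, but a point lies on
    at most three cosets. *)
Lemma incident_neq p q x y u w : p != q -> x != y -> p != x -> p != y ->
  adjacent q x -> adjacent q y -> incident p u -> incident x u ->
  incident y w -> u != w.
Proof.
move=> pq xy px py qx qy pu xu yw; apply/eqP => uw; rewrite -uw in yw.
have [v [qv xv yv]] : exists v, [/\ incident q v, incident x v & incident y v].
  apply: adjacent_triangle => //; last exact: adjacent_sym.
  by split=> //; exists u.
have vu : v = u := incident_inj xy xv yv xu yw.
apply: (@incident4 u p q x y) => //; last by rewrite -vu.
by rewrite /= !inE !negb_or pq px py xy qx.1 qy.1.
Qed.

(** Each x in [r] gives a path from p to q. The letters at p are distinct, and so are those at q, so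
    the labelled theta graph is a refuted one. *)
Lemma no_theta p q (r : seq G) : p != q -> uniq r -> size r = 3 ->
  {in r, forall x, adjacent p x} -> {in r, forall x, adjacent q x} -> False.
Proof.
move=> pq ur sr pr qr.
(* If x met p and q in the same point, the triangle p, q, y for another y in [r] would put a fourth
   coset through it. *)
have apart x : x \in r -> exists u w, [/\ incident p u, incident x u,
    incident q w, incident x w & u != w].
  move=> xr; have [px [u pu xu]] := pr x xr; have [qx [w qw xw]] := qr x xr.
  exists u, w; split=> //; apply/eqP => uw; rewrite -{w}uw in qw xw.
  have [y yr xy] : exists2 y, y \in r & x != y.
    case: r ur sr {pr qr xr} => [|a [|b r]] //=; rewrite inE negb_or.
    case/andP=> /andP[ab _] _ _; have [->|xa] := eqVneq x a.
      by exists b; rewrite // !inE eqxx orbT.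
    by exists a; rewrite // inE eqxx.
  have [v [pv qv yv]] : exists v,
      [/\ incident p v, incident q v & incident y v].
    apply: adjacent_triangle (qr y yr) (adjacent_sym (pr y yr)).
    by split=> //; exists u.
  have vu : v = u := incident_inj pq pv qv pu qw; rewrite vu in yv.
  apply: (@incident4 u p q x y) => //.
  by rewrite /= !inE !negb_or pq px xy qx (pr y yr).1 (qr y yr).1.
have letters x : exists l : nat * nat * nat * nat, x \in r ->
    [/\ l.1.1.1 < 3, l.1.1.2 < 3, l.1.2 < 3 & l.2 < 3] /\
    [/\ p * c l.1.1.1 = x * c l.1.1.2, q * c l.2 = x * c l.1.2
      & p * c l.1.1.1 != q * c l.2]%g.
  case: (boolP (x \in r)) => [xr|]; last by exists (0, 0, 0, 0).
  have [u [w [/incidentP[i i3 ->] /incidentP[j j3 ij]]]] := apart x xr.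
  move=> /incidentP[k k3 ->] /incidentP[l l3 kl] uw.
  by exists (i, j, l, k).
have {letters} [l lP] := boolp.choice letters.
have nadj a x i j : adjacent a x -> (a * c i = x * c j)%g -> i != j.
  by case=> ax _; apply: contra_eq_neq => ->; apply: contraNneq ax => /mulIg->.
have inj_p : {in r &, injective (fun x => (l x).1.1.1)}.
  move=> x y xr yr; have [[? ? _ _] [xE _ _]] := lP x xr.
  have [[? ? _ _] [yE _ _]] := lP y yr.
  apply: contra_eq => xy; have [px _] := pr x xr; have [py _] := pr y yr.
  suff : (p * c (l x).1.1.1)%g != (p * c (l y).1.1.1)%g.
    by apply: contra_neq => ->.
  apply: (incident_neq pq xy px py (qr x xr) (qr y yr)); apply/incidentP.
  - by exists (l x).1.1.1.
  - by exists (l x).1.1.2.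
  - by exists (l y).1.1.2.
have inj_q : {in r &, injective (fun x => (l x).2)}.
  move=> x y xr yr; have [[_ _ ? ?] [_ xE _]] := lP x xr.
  have [[_ _ ? ?] [_ yE _]] := lP y yr.
  apply: contra_eq => xy; have [qx _] := qr x xr; have [qy _] := qr y yr.
  suff : (q * c (l x).2)%g != (q * c (l y).2)%g by apply: contra_neq => ->.
  rewrite eq_sym in pq.
  apply: (incident_neq pq xy qx qy (pr x xr) (pr y yr)); apply/incidentP.
  - by exists (l x).2.
  - by exists (l x).1.2.
  - by exists (l y).1.2.
(* Three distinct letters exhaust 0, 1, 2, so the paths can be indexed by their letter at p. *)
have surj i : i < 3 -> exists2 x, x \in r & (l x).1.1.1 = i.
  move=> i3; pose t := [seq (l x).1.1.1 | x <- r].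
  suff : i \in t by case/mapP=> x xr ->; exists x.
  have [_ ->] : (size t = size (iota 0 3)) * (t =i iota 0 3).
    apply: uniq_min_size; rewrite ?size_map ?sr ?map_inj_in_uniq //.
    by move=> _ /mapP[x /lP[[+ _ _ _] _] ->]; rewrite mem_iota.
  by rewrite mem_iota.
have [x0 x0r l0] := surj 0 isT; have [x1 x1r l1] := surj 1 isT.
have [x2 x2r l2] := surj 2 isT.
pose a := [seq (l x).1.1.2 | x <- [:: x0; x1; x2]].
pose b := [seq (l x).1.2 | x <- [:: x0; x1; x2]].
pose d := [seq (l x).2 | x <- [:: x0; x1; x2]].
have [[_ a0 b0 d0] [p0 q0 pq0]] := lP x0 x0r.
have [[_ a1 b1 d1] [p1 q1 pq1]] := lP x1 x1r.
have [[_ a2 b2 d2] [p2 q2 pq2]] := lP x2 x2r.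
have aT : a \in triples by exact: mem_triples.
have bT : b \in triples by exact: mem_triples.
have dT : d \in triples by exact: mem_triples.
have valid : theta_valid a b d.
  have ba x (xr : x \in r) : (l x).1.2 != (l x).1.1.2.
    by have [_ [-> ->]] := lP x xr; apply: contra_neq => ->.
  have da x (xr : x \in r) : (l x).2 != (l x).1.2.
    by have [_ [_ + _]] := lP x xr; apply: nadj; exact: qr.
  have ai x (xr : x \in r) : (l x).1.1.2 != (l x).1.1.1.
    by have [_ [+ _ _]] := lP x xr; rewrite eq_sym; apply: nadj; exact: pr.
  apply/andP; split; last first.
    by rewrite /= -{1}l0 -{1}l1 -{1}l2 !ba // !da // !ai.
  rewrite map_inj_in_uniq; last first.
    by move=> x y; rewrite !inE => /or3P[]/eqP-> /or3P[]/eqP->; apply: inj_q.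
  have ne x y : (l x).1.1.1 != (l y).1.1.1 -> x != y by apply: contra_neq => ->.
  by rewrite /= !inE !negb_or !ne ?l0 ?l1 ?l2.
have /allP/(_ _ aT)/allP/(_ _ bT)/allP/(_ _ dT) := theta_refuted.
rewrite valid; apply/negP/(refuteN tfG altN) => w.
have word i : i \in [:: 0; 1; 2] -> eval c (theta_word a b d i) = (p^-1 * q)%g.
  have E x : x \in r -> (c (l x).1.1.1 * ((c (l x).1.1.2)^-1 *
      (c (l x).1.2 * ((c (l x).2)^-1 * 1))) = p^-1 * q)%g.
    move=> xr; have [_ [pE qE _]] := lP x xr; apply: (mulgI p).
    by rewrite mulg1 mulVKg !mulgA pE mulgK -qE mulgK.
  rewrite !inE => /or3P[] /eqP->; rewrite /theta_word /eval /eval_letter /=.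
  - by rewrite -{1}l0 E.
  - by rewrite -{1}l1 E.
  - by rewrite -{1}l2 E.
case/mapP => -[i j] ij ->; rewrite eval_cat eval_inv !word ?mulgV //.
  by move: ij; rewrite !inE => /or3P[] /eqP[_ ->].
by move: ij; rewrite !inE => /or3P[] /eqP[-> _].
Qed.

Lemma perm_extend (T : eqType) (s t : seq T) : uniq s -> uniq t ->
  {subset t <= s} -> exists r, perm_eq s (r ++ t).
Proof.
move=> us ut ts; exists [seq x <- s | x \notin t].
apply: uniq_perm => // [|x].
  rewrite cat_uniq filter_uniq // ut andbT -all_predC.
  by apply/allP => x xt; rewrite /= mem_filter xt.
rewrite mem_cat mem_filter; case: (boolP (x \in t)) => [/ts->|_] //.
by rewrite orbF.
Qed.

(** Fewer than 10 points force an overlap of 2 or 3 for [a], and either case makes the five elements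
    contain K_{2,3}. *)
Lemma cover5 s : uniq s -> size s = 5 -> 10 <= cover s.
Proof.
case: s => //= a s /andP[as_ us] [ss]; rewrite leqNgt; apply/negP => lt10.
have ge8 := cover4 us ss; have le3 := overlap_le3 s a.
have cov := cover_cons a s.
have [t [ut tE ts at_ ind]] := overlap_witness as_.
have [r srt] := perm_extend us ut ts.
have cE : cover s = cover (r ++ t) by congr #|` _|; exact/eq_seq_mul/perm_mem.
have urt : uniq (r ++ t) by rewrite -(perm_uniq srt).
have sz : size r + overlap s a = 4 by rewrite -tE -size_cat -(perm_size srt).
have art x : x \in r ++ t -> a != x.
  by rewrite -(perm_mem srt) => xs; apply: contraNneq as_ => ->.
have ct := cover_independent ut ind.
have [ov|ov3] := eqVneq (overlap s a) 3; last first.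
  (* Overlap 2: the remaining y and z are adjacent to both elements of [t], so K_{2,3} has the parts
     [t] and {a, y, z}. *)
  have ov : overlap s a = 2 by lia.
  have szr : size r = 2 by lia.
  case: r szr {sz srt} cE urt art => [|y [|z []]] //= _ cE urt art.
  have st : size t = 2 by rewrite tE.
  (* If v met at most one point of [t], then v and [t] would cover at least 8 points and u would add
     none; its overlap 3 would make them independent, covering 9. *)
  have second (u v : G) :
      v \notin t -> u \notin v :: t -> cover (u :: v :: t) <= 8 ->
      {in t, forall x, adjacent v x}.
    move=> vt; have := cover_cons v t; have := overlap_le_size vt.
    have : uniq (v :: t) by rewrite /= vt.
    have : size (v :: t) = 3 by rewrite /= st.
    move: (v :: t) => vt' svt' uvt'; rewrite ct st => le2 covt' uvt.
    have := overlap_le_size uvt; have := cover_cons u vt'; rewrite svt'.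
    have [ovv _ _ _|ovv] := eqVneq (overlap t v) 2.
      by case: (overlap_eq_size ut vt); rewrite ?st.
    have [ovu|] := eqVneq (overlap vt' u) 3; last by move=> *; exfalso; lia.
    case: (overlap_eq_size uvt' uvt); rewrite svt' // => -> _ _ *.
    by exfalso; lia.
  have [yzt zt] : y \notin z :: t /\ z \notin t by case/and3P: urt.
  have [zyt yt] : z \notin y :: t /\ y \notin t.
    by move: yzt; rewrite !inE !negb_or eq_sym => /andP[->].
  have yzC : cover [:: y, z & t] = cover [:: z, y & t].
    by congr #|` _|; apply: eq_seq_mul => x; rewrite !inE orbCA.
  have cov8 : cover [:: y, z & t] <= 8 by rewrite -cE; lia.
  have zadj := second _ _ zt yzt cov8; rewrite yzC in cov8.
  have yadj := second _ _ yt zyt cov8.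
  have [x0 [x1 tE2]] : exists x0 x1, t = [:: x0; x1].
    by case: (t) st => [|x0 [|x1 []]] // _; exists x0, x1.
  have [x0t x1t] : x0 \in t /\ x1 \in t by rewrite tE2 !inE !eqxx orbT.
  have adj x : x \in t -> {in [:: a; y; z], forall w, adjacent x w}.
    move=> xt w; rewrite !inE => /or3P[] /eqP->; apply: adjacent_sym.
    - exact: at_.
    - exact: yadj.
    - exact: zadj.
  apply: (no_theta _ _ _ (adj _ x0t) (adj _ x1t)) => //.
    by move: ut; rewrite tE2 /= inE andbT.
  have yz : y != z by move: yzt; rewrite inE => /norP[].
  by rewrite /= !inE yz negb_or !art ?inE ?eqxx ?orbT.
(* Overlap 3: the remaining z adds nothing to the 9 points of [t], so z, like a, is adjacent to all
   of [t]. *)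
have szr : size r = 1 by lia.
case: r szr {sz srt} cE urt art => [|z []] //= _ cE /andP[zt _] az.
have := cover_cons z t; have := overlap_le3 t z; rewrite ct tE ov => le3' cov'.
have [|_ zadj _] := overlap_eq_size ut zt; first by rewrite tE; lia.
apply: (@no_theta a z t) => //; first by rewrite az ?mem_head.
by rewrite tE.
Qed.

(** Two nonadjacent neighbours of a in [s] must both differ from b. Their triangles with a and b
    pass through the common point of a and b, so they would be adjacent after all. *)
Lemma overlap_star s a b : a \notin s -> adjacent a b ->
  {in s, forall x, x != b -> adjacent b x} -> overlap s a <= 1.
Proof.
move=> /overlap_witness[t [ut <- ts at_ ind]] ab bs.
case: t ut ts at_ ind => [|x [|y t]] // /andP[+ _] ts at_ ind.
rewrite inE negb_or => /andP[xy _].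
have [xt yt] : x \in [:: x, y & t] /\ y \in [:: x, y & t].
  by rewrite !inE !eqxx orbT.
have [xb|xb] := eqVneq x b.
  case: (ind x y) => //; rewrite xb; apply: bs (ts _ yt) _.
  by rewrite -xb eq_sym.
have [yb|yb] := eqVneq y b.
  by case: (ind y x) => //; rewrite yb; apply: bs (ts _ xt) _.
have common w : w \in [:: x, y & t] -> w != b ->
    exists v, [/\ incident a v, incident b v & incident w v].
  move=> wt wb; apply: adjacent_triangle ab (bs _ (ts _ wt) wb) _.
  exact/adjacent_sym/at_.
have [v [av bv xv]] := common _ xt xb; have [w [aw bw yw]] := common _ yt yb.
case: (ind x y) => //; split=> //; exists v => //.
by rewrite (incident_inj ab.1 av bv aw bw).
Qed.

Lemma cover_star (b x y z : G) : uniq [:: z; y; x; b] ->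
  adjacent b x -> adjacent b y -> adjacent b z -> 9 <= cover [:: z; y; x; b].
Proof.
move=> /= /and4P[zs ys xs _] bx by_ bz.
have zs1 : overlap [:: y; x; b] z <= 1.
  apply: overlap_star zs (adjacent_sym bz) _ => w.
  by rewrite !inE => /or3P[] /eqP-> //; rewrite eqxx.
have ys1 : overlap [:: x; b] y <= 1.
  apply: overlap_star ys (adjacent_sym by_) _ => w.
  by rewrite !inE => /orP[] /eqP-> //; rewrite eqxx.
have xs1 : overlap [:: b] x <= 1 by exact: overlap_le_size xs.
have := cover_cons z [:: y; x; b]; have := cover_cons y [:: x; b].
have := cover_cons x [:: b]; rewrite (@cover1 [:: b]) //; lia.
Qed.

Lemma cover_fset (B : {fset G}) : cover B = #|` fset_mulg B C|.
Proof.
rewrite /cover /seq_mul; congr #|` fset_mulg _ C|; apply/fsetP => x.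
by rewrite in_fset.
Qed.

(** * Translates and unions of finite sets *)

Lemma fset_mulgS (A B : {fset G}) :
  (A `<=` B)%fset -> (fset_mulg A C `<=` fset_mulg B C)%fset.
Proof.
move=> /fsubsetP AB; apply/fsubsetP => v; rewrite !mem_fset_mulg.
by case/hasP => a aA av; apply/hasP; exists a; [exact: AB|].
Qed.

Definition translate (g : G) (B : {fset G}) : {fset G} :=
  [fset g * b | b in B]%g%fset.

Lemma mem_translate g B v : (v \in translate g B) = (g^-1 * v \in B)%g.
Proof.
apply/imfsetP/idP => [[b bB ->]|gv]; first by rewrite mulKg.
by exists (g^-1 * v)%g; rewrite ?mulVKg.
Qed.

Lemma card_translate g B : #|` translate g B| = #|` B|.
Proof. by rewrite card_imfset //; exact: mulgI. Qed.

Lemma incident_translate g b v : incident (g * b)%g v = incident b (g^-1 * v)%g.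
Proof. by rewrite /incident invgM mulgA. Qed.

Lemma fset_mulg_translate g B :
  fset_mulg (translate g B) C = translate g (fset_mulg B C).
Proof.
apply/fsetP => v; rewrite mem_translate !mem_fset_mulg.
apply/hasP/hasP => [[b]|[b bB bv]].
  rewrite mem_translate => gb bv; exists (g^-1 * b)%g => //.
  by rewrite -(mulVKg g b) incident_translate in bv.
by exists (g * b)%g; rewrite ?incident_translate // mem_translate mulKg.
Qed.

Lemma fset_mulgU A B :
  fset_mulg (A `|` B)%fset C = (fset_mulg A C `|` fset_mulg B C)%fset.
Proof.
apply/fsetP => v; rewrite in_fsetU !mem_fset_mulg.
apply/hasP/orP => [[b]|[]/hasP[b bX bv]].
- by rewrite in_fsetU => /orP[] bX bv; [left|right]; apply/hasP; exists b.
- by exists b => //; rewrite in_fsetU bX.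
- by exists b => //; rewrite in_fsetU bX orbT.
Qed.

(** A finite set fixed by g would contain the infinitely many elements g^n b. *)
Lemma translate_neq g (B : {fset G}) b :
  b \in B -> g != 1%g -> translate g B != B.
Proof.
move=> bB g1; apply/eqP => gB.
have gXB n : (g ^+ n * b)%g \in B.
  elim: n => [|n IH]; first by rewrite mul1g.
  by rewrite -gB mem_translate expgS -!mulgA mulKg.
suff inj : injective (fun n => g ^+ n * b)%g.
  have : size [seq (g ^+ n * b)%g | n <- iota 0 (#|` B|).+1] <= #|` B|.
    apply: uniq_leq_size; first by rewrite map_inj_uniq // iota_uniq.
    by move=> _ /mapP[n _ ->].
  by rewrite size_map size_iota ltnn.
move=> i j /mulIg; wlog ij : i j / i <= j => [W|].
  by case/orP: (leq_total i j) => ij; [exact: W|move/esym/(W j i ij)].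
rewrite -{1}(subnK ij) expgnDr -[LHS]mul1g => /mulIg/esym gji.
apply/eqP; rewrite eqn_leq ij leqNgt -subn_gt0; apply: contra_neqN g1 => ji.
exact: tfG gji.
Qed.

Lemma exchange_count (T U : eqType) (r : T -> U -> bool)
    (s : seq T) (t : seq U) :
  \sum_(x <- s) count (r x) t = \sum_(y <- t) count (r^~ y) s.
Proof.
have E (V : eqType) (p : pred V) (u : seq V) :
    count p u = \sum_(x <- u) (p x : nat).
  by rewrite -sum1_count big_mkcond; apply: eq_bigr => x _; case: (p x).
under eq_bigr do rewrite E; rewrite exchange_big /=.
by apply: eq_bigr => y _; rewrite E.
Qed.

(* An atom in the sense of Hamidoune: a smallest set among those of cardinality
   at least 5 that minimize |BC| - |B|. *)
Section Atom.
Variables (B : {fset G}) (m : nat).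
Hypotheses (m4 : m <= 4) (B5 : 5 <= #|` B|).
Hypothesis card_BC : #|` fset_mulg B C| = #|` B| + m.
Hypothesis B_min : forall X : {fset G}, 5 <= #|` X| ->
  #|` X| + m <= #|` fset_mulg X C|.
Hypothesis B_smallest : forall X : {fset G}, 5 <= #|` X| < #|` B| ->
  #|` X| + m < #|` fset_mulg X C|.

Lemma card_ge10 (X : {fset G}) : #|` X| = 5 -> 10 <= #|` fset_mulg X C|.
Proof. by move=> X5; rewrite -cover_fset cover5 ?fset_uniq. Qed.

Lemma atom_gt5 : 5 < #|` B|.
Proof.
rewrite ltn_neqAle B5 andbT; apply/eqP => B5'.
by have := card_ge10 (esym B5'); rewrite card_BC -B5'; lia.
Qed.

(** If [v] were covered by [a] alone, deleting [a] would lose a point and leave a smaller minimizer,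
    still with at least 5 elements. *)
Lemma atom_neighbor a v : a \in B -> incident a v ->
  exists b, [/\ b \in B, b != a & incident b v].
Proof.
move=> aB av; apply: contrapT => noB.
have Xcard : #|` B| = #|` B `\ a|%fset.+1 by rewrite (cardfsD1 a) aB.
have vBC : v \in fset_mulg B C by rewrite mem_fset_mulg; apply/hasP; exists a.
have XC : (fset_mulg (B `\ a) C `<=` fset_mulg B C `\ v)%fset.
  rewrite fsubsetD1 fset_mulgS ?fsubD1set //= mem_fset_mulg.
  apply/hasPn => b; rewrite in_fsetD1 => /andP[ba bB].
  by apply/negP => bv; apply: noB; exists b.
have := B_smallest (X := (B `\ a)%fset); have := atom_gt5.
have := fsubset_leq_card XC; have := cardfsD1 v (fset_mulg B C).
rewrite vBC card_BC Xcard; lia.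
Qed.

(** For f(X) = |XC| - |X|, submodularity bounds the sum of f over union and intersection by 2m, and
    the union contributes at least m. An intersection of 5 or more elements would be a smaller
    minimizer. *)
Lemma atom_inter g : g != 1%g -> let X := (translate g B `&` B)%fset in
  #|` X| <= 4 /\ #|` fset_mulg X C| <= #|` X| + m.
Proof.
move=> g1 X.
have XC : #|` fset_mulg X C| <= #|` X| + m.
  have XCs : (fset_mulg X C `<=`
      translate g (fset_mulg B C) `&` fset_mulg B C)%fset.
    rewrite fsubsetI -fset_mulg_translate.
    by rewrite !fset_mulgS ?fsubsetIl ?fsubsetIr.
  have UI := cardfsUI (translate g B) B.
  have UIC := cardfsUI (translate g (fset_mulg B C)) (fset_mulg B C).
  rewrite -{1}fset_mulg_translate -fset_mulgU in UIC.
  have := fsubset_leq_card XCs; have := B_min (X := (translate g B `|` B)%fset).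
  have := fsubset_leq_card (fsubsetUr (translate g B) B).
  move: UI UIC; rewrite -/X !card_translate card_BC; lia.
split=> //; rewrite leqNgt; apply/negP => X5.
have XB : #|` X| < #|` B|.
  rewrite ltn_neqAle fsubset_leq_card ?fsubsetIr // andbT.
  have /fset0Pn[b bB] : B != fset0 by rewrite -cardfs_gt0; apply: leq_trans B5.
  apply: contra (translate_neq bB g1) => /eqP XB.
  have XeB : X = B by apply/eqP; rewrite eqEfcard fsubsetIr XB leqnn.
  rewrite eq_sym eqEfcard card_translate leqnn andbT -{1}XeB; exact: fsubsetIl.
have := B_smallest (X := X); rewrite X5 XB => /(_ isT); lia.
Qed.

(** * Codes of the elements of an atom *)

Definition step (b : G) i j : G := (b * c i / c j)%g.

Lemma incident_step b i j : i < 3 -> j < 3 -> incident (step b i j) (b * c i)%g.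
Proof. by move=> i3 j3; apply/incidentP; exists j; rewrite ?divgK. Qed.

Lemma step_neq b i j : i < 3 -> j < 3 -> i != j -> b != step b i j.
Proof.
move=> i3 j3; apply: contra_neq => bE; apply: c_inj => //.
by apply: (mulgI b); rewrite {2}bE divgK.
Qed.

Lemma adjacent_step b i j : i < 3 -> j < 3 -> i != j -> adjacent b (step b i j).
Proof.
move=> i3 j3 ij; split; first exact: step_neq.
by exists (b * c i)%g; [apply/incidentP; exists i|exact: incident_step].
Qed.

Definition fits (b : G) (t : code) : bool :=
  all (fun i => step b i (nxt t i) \in B) (iota 0 3).

Lemma fitsP b t :
  reflect (forall i, i < 3 -> step b i (nxt t i) \in B) (fits b t).
Proof.
apply: (iffP allP) => bt i; first by move=> i3; apply: bt; rewrite mem_iota.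
by rewrite mem_iota => /bt.
Qed.

Lemma atom_step b i : b \in B -> i < 3 ->
  exists j, [/\ j < 3, j != i & step b i j \in B].
Proof.
move=> bB i3; have bv : incident b (b * c i)%g by apply/incidentP; exists i.
have [a [aB ab /incidentP[j j3 vE]]] := atom_neighbor bB bv.
have aE : step b i j = a by rewrite /step vE mulgK.
exists j; split=> //; last by rewrite aE.
by apply: contraNneq ab => ij; rewrite -aE /step ij mulgK.
Qed.

Lemma fits_exists b : b \in B -> exists t, fits b t.
Proof.
move=> bB; have [j0 [j03 n0 b0]] := atom_step (i := 0) bB isT.
have [j1 [j13 n1 b1]] := atom_step (i := 1) bB isT.
have [j2 [j23 n2 b2]] := atom_step (i := 2) bB isT.
have [t [t0 t1 t2]] := nxt_code j03 j13 j23 n0 n1 n2.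
by exists t; rewrite /fits /= t0 t1 t2 b0 b1 b2.
Qed.

(** For g = b a^-1 the intersection of gB and B contains b and the three neighbours chosen by t.
    Having at most 4 elements, it is this star, which covers at least 9 points, more than 4 + m. *)
Lemma fits_inj a b t : a \in B -> b \in B -> fits a t -> fits b t -> a = b.
Proof.
move=> aB bB /fitsP at_ /fitsP bt; apply/eqP/negP => /negP ab.
pose s i := step b i (nxt t i); pose l := [:: s 2; s 1; s 0; b].
have s_adj i : i < 3 -> adjacent b (s i).
  by move=> i3; apply: adjacent_step; rewrite ?nxt_lt3 // eq_sym nxt_neq.
have s_inj i j : i < 3 -> j < 3 -> i != j -> s i != s j.
  move=> i3 j3; apply: contra_neq => sij; apply: c_inj => //; apply: (mulgI b).
  apply: (incident_inj (s_adj i i3).1).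
  - by apply/incidentP; exists i.
  - exact: incident_step (nxt_lt3 _ _).
  - by apply/incidentP; exists j.
  - by rewrite sij; apply: incident_step (nxt_lt3 _ _).
have ul : uniq l.
  rewrite /= !inE !negb_or !s_inj //.
  by do ![rewrite eq_sym (s_adj _ _).1 //].
have g1 : (b / a)%g != 1%g by rewrite divg_eq1 eq_sym.
have [X4 XC] := atom_inter g1; set X := (_ `&` _)%fset in X4 XC.
have lX : {subset l <= X}.
  have sX i : i < 3 -> s i \in X.
    move=> i3; rewrite in_fsetI bt // andbT mem_translate.
    by rewrite invgF /s /step !mulgA divgK; exact: at_.
  have bX : b \in X by rewrite in_fsetI bB andbT mem_translate invgF divgK.
  by apply/allP; rewrite /= !sX //= bX.
have [_ lXe] := uniq_min_size ul lX X4.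
have := cover_star ul (s_adj 0 isT) (s_adj 1 isT) (s_adj 2 isT).
have -> : cover l = #|` fset_mulg X C|.
  by rewrite -cover_fset; congr #|` _|; exact: eq_seq_mul.
by move=> XC9; have := leq_trans XC9 XC; lia.
Qed.

Lemma fits_update a t i x y : fits a t -> i < 3 -> x \in B -> y \in B ->
  uniq [:: a; x; y] -> incident x (a * c i)%g -> incident y (a * c i)%g ->
  exists2 t', fits a t' & t' != t.
Proof.
move=> /fitsP at_ i3 xB yB; rewrite /= !inE negb_or andbT.
move=> /andP[/andP[ax ay] xy].
move=> /incidentP[j j3 xE] /incidentP[k k3 yE].
have jE : step a i j = x by rewrite /step xE mulgK.
have kE : step a i k = y by rewrite /step yE mulgK.
have ji : j != i by apply: contraNneq ax => ji; rewrite -jE /step ji mulgK.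
have ki : k != i by apply: contraNneq ay => ki; rewrite -kE /step ki mulgK.
have jk : j != k by apply: contraNneq xy => jk; rewrite -jE -kE jk.
have [l [l3 li lt lB]] : exists l,
    [/\ l < 3, l != i, l != nxt t i & step a i l \in B].
  have [jt|jt] := eqVneq j (nxt t i); last by exists j; rewrite jE.
  by exists k; rewrite kE -jt (eq_sym k j).
have [t' t'i t'E] := nxt_update t i3 l3 li.
exists t'; last by apply: contraNneq lt => <-; rewrite t'i.
apply/fitsP => e e3; have [->|ei] := eqVneq e i; first by rewrite t'i.
by rewrite t'E //; exact: at_.
Qed.

Lemma atom_code : exists f : G -> code, {in B, forall b, fits b (f b)}.
Proof.
suff /boolp.choice[f fP] : forall b, exists t, b \in B -> fits b t by exists f.
move=> b; case: (boolP (b \in B)) => [/fits_exists[t bt]|]; first by exists t.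
by exists (true, true, true).
Qed.

(** Three elements on one point would each fit a second code. Together with one code for each of the
    at least 6 elements of B, this makes at least 9 distinct codes out of 8. *)
Lemma incident_atom2 v a b d : uniq [:: a; b; d] -> a \in B -> b \in B ->
  d \in B -> incident a v -> incident b v -> incident d v -> False.
Proof.
move=> u3 aB bB dB av bv dv; have [f fB] := atom_code.
have second x y z : x \in B -> y \in B -> z \in B -> uniq [:: x; y; z] ->
    incident x v -> incident y v -> incident z v ->
    exists t, [/\ x \in B, fits x t & t != f x].
  move=> xB yB zB xyz /incidentP[i i3 ->] yv zv.
  by have [t] := fits_update (fB _ xB) i3 yB zB xyz yv zv; exists t.
have [ta [_ at_ taN]] := second _ _ _ aB bB dB u3 av bv dv.
have u3' : uniq [:: b; d; a] by rewrite -(rot_uniq 1) in u3.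
have [tb [_ bt tbN]] := second _ _ _ bB dB aB u3' bv dv av.
have u3'' : uniq [:: d; a; b] by rewrite -(rot_uniq 2) in u3.
have [td [_ dt tdN]] := second _ _ _ dB aB bB u3'' dv av bv.
have f_inj : {in B &, injective f}.
  move=> x y xB yB fxy; apply: (fits_inj xB yB (fB _ xB)).
  by rewrite fxy; exact: fB.
have new x t : x \in B -> fits x t -> t != f x -> t \notin [seq f b | b <- B].
  move=> xB xt; apply: contraNN => /mapP[y yB ty]; rewrite ty.
  by rewrite (@fits_inj x y t) // ty fB.
have neq x y t t' :
    x \in B -> y \in B -> fits x t -> fits y t' -> x != y -> t != t'.
  move=> xB yB xt yt; apply: contra_neq => tt.
  by apply: fits_inj xt _; rewrite ?tt.
have : size ([seq f b | b <- B] ++ [:: ta; tb; td]) <= size codes.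
  apply: uniq_leq_size => [|t _]; last exact: mem_codes.
  rewrite cat_uniq map_inj_in_uniq // fset_uniq /=.
  rewrite (negbTE (new _ _ aB at_ taN)) (negbTE (new _ _ bB bt tbN)).
  rewrite (negbTE (new _ _ dB dt tdN)) /= !inE negb_or.
  have /and3P[+ + _] := u3; rewrite !inE negb_or => /andP[ab ad] bd.
  by rewrite (neq a b) // (neq a d) // (neq b d).
by rewrite size_cat size_map => /(leq_trans (leq_add atom_gt5 (leqnn 3))).
Qed.

Lemma atom_le8 : #|` B| <= 8.
Proof.
have [f fB] := atom_code; rewrite -(size_map f).
apply: (@leq_trans (size codes)) => //.
apply: uniq_leq_size => [|t _]; last exact: mem_codes.
rewrite map_inj_in_uniq ?fset_uniq // => x y xB yB fxy.
by apply: (fits_inj xB yB (fB _ xB)); rewrite fxy; exact: fB.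
Qed.

(** Each element has three points, and each point lies on exactly two elements by [atom_neighbor]
    and [incident_atom2]. *)
Lemma atom_double_count : #|` B| * 3 = #|` fset_mulg B C| * 2.
Proof.
have := exchange_count incident B (fset_mulg B C).
rewrite (eq_big_seq (fun=> 3)) => [|b bB]; last first.
  rewrite -(card_lcoset b) -size_filter; apply/perm_size/uniq_perm.
  - by rewrite filter_uniq ?fset_uniq.
  - exact: fset_uniq.
  move=> v; rewrite mem_filter mem_lcoset.
  case: (boolP (incident b v)) => //= bv.
  by rewrite mem_fset_mulg; apply/hasP; exists b.
rewrite big_const_seq count_predT iter_addn_0 mulnC => ->.
rewrite (eq_big_seq (fun=> 2)) => [|v]; last first.
  rewrite mem_fset_mulg => /hasP[a aB av].
  have [b [bB ba bv]] := atom_neighbor aB av.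
  rewrite -size_filter -[RHS]/(size [:: a; b]); apply/perm_size/uniq_perm.
  - by rewrite filter_uniq ?fset_uniq.
  - by rewrite /= inE eq_sym ba.
  move=> x; rewrite mem_filter !inE; apply/andP/orP; last first.
    by case=> /eqP->.
  case=> xv xB; apply/orP; apply: contraT; rewrite negb_or => /andP[xa xb].
  by case: (@incident_atom2 v x a b); rewrite //= !inE negb_or xa xb eq_sym ba.
by rewrite big_const_seq count_predT iter_addn_0 mulnC.
Qed.

(** The double count gives |B| = 2m, hence 6 or 8. Six elements would cover 9 points, but five of
    them already cover 10. *)
Lemma atom_card8 : #|` B| = 8.
Proof.
have := atom_double_count; rewrite card_BC => dc.
have [B6|] := eqVneq #|` B| 6; last by have := atom_gt5; have := atom_le8; lia.
have /fset0Pn[b bB] : B != fset0 by rewrite -cardfs_gt0 B6.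
have X5 : #|` B `\ b|%fset = 5 by have := cardfsD1 b B; rewrite bB B6 => -[].
have := card_ge10 X5; have := fsubset_leq_card (fset_mulgS (fsubD1set B b)).
by rewrite card_BC; lia.
Qed.

(** Eight elements with distinct codes realize each code once, and [g] inverts the coding. The steps
    then form matchings excluded by computation. *)
Lemma atom_absurd : False.
Proof.
have [f fB] := atom_code.
have f_inj : {in B &, injective f}.
  move=> x y xB yB fxy; apply: (fits_inj xB yB (fB _ xB)).
  by rewrite fxy; exact: fB.
have [g gP] : exists g, forall t, g t \in B /\ f (g t) = t.
  suff /boolp.choice[g gP] : forall t, exists b, b \in B /\ f b = t by exists g.
  move=> t; suff : t \in [seq f b | b <- B] by case/mapP=> b bB ->; exists b.
  have [_ ->] : (size [seq f b | b <- B] = size codes) *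
                ([seq f b | b <- B] =i codes); last exact: mem_codes.
  apply: uniq_min_size => [|x _|]; rewrite ?mem_codes ?size_map ?atom_card8 //.
  by rewrite map_inj_in_uniq ?fset_uniq.
have fK b : b \in B -> g (f b) = b.
  by move=> bB; apply: f_inj => //; [exact: (gP _).1|exact: (gP _).2].
have g_step t i : i < 3 -> step (g t) i (nxt t i) \in B.
  move=> i3; have [gB gt] := gP t.
  by have /fitsP/(_ i i3) := fB _ gB; rewrite gt.
(* The code of the neighbour leads back through the shared point; otherwise a third element would
   lie on it. *)
have nxtK t i j : i < 3 -> j < 3 -> nxt t i = j ->
    step (g t) i j \in B /\ nxt (f (step (g t) i j)) j = i.
  move=> i3 j3 tij; have xB := g_step t i i3; rewrite tij in xB.
  set x := step _ _ _ in xB *; split=> //.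
  have ij : i != j by rewrite -tij eq_sym nxt_neq.
  have yB := g_step (f x) j j3; rewrite fK // in yB.
  move: (nxt_lt3 (f x) j) (nxt_neq (f x) j3) yB; move: (nxt _ _) => k k3 kj yB.
  apply/eqP; apply: contraT => ki.
  have xE : (x * c j = g t * c i)%g by rewrite /x /step divgK.
  case: (@incident_atom2 (g t * c i)%g (g t) x (step x j k)) => //.
  - rewrite /= !inE negb_or !step_neq // 1?eq_sym // !andbT.
    apply: contra_neq ki => gE; apply: c_inj => //.
    by apply: (mulgI (g t)); rewrite -{1}gE divgK xE.
  - exact: (gP t).1.
  - by apply/incidentP; exists i.
  - exact: incident_step.
  - by rewrite -xE; exact: incident_step.
have matching i j : i < 3 -> j < 3 -> i != j ->
    size (codes_to i j) = size (codes_to j i) ->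
    exists2 p, p \in matchings i j & realizes c g (edges i j p).
  move=> i3 j3 ij sz; pose h t := f (step (g t) i j).
  have hP t : t \in codes_to i j ->
      [/\ step (g t) i j \in B, nxt (h t) j = i & g (h t) = step (g t) i j].
    rewrite mem_filter => /andP[/eqP tij _].
    by have [xB xj] := nxtK t i j i3 j3 tij; rewrite fK.
  have zipE : zip (codes_to i j) (map h (codes_to i j)) =
              [seq (t, h t) | t <- codes_to i j].
    by rewrite -{1}(map_id (codes_to i j)) zip_map.
  exists (map h (codes_to i j)).
    rewrite mem_filter mem_permutations zipE; apply/andP; split.
      apply/allP => _ /mapP[t /hP[_ _ gh] ->] /=; apply/eqP => tE.
      by have := step_neq (g t) i3 j3 ij; rewrite -gh -tE eqxx.
    have up : uniq (map h (codes_to i j)).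
      rewrite map_inj_in_uniq ?filter_uniq // => t u /hP[tB _ _] /hP[uB _ _].
      move/f_inj; move/(_ tB uB)/mulIg/mulIg => gE.
      by rewrite -(gP t).2 gE (gP u).2.
    have [||_ pE] := uniq_min_size (s2 := codes_to j i) up.
    - by move=> _ /mapP[t /hP[_ ht _] ->]; rewrite mem_filter ht eqxx mem_codes.
    - by rewrite size_map sz.
    by apply: uniq_perm => //; rewrite filter_uniq.
  have E : realizes c g
      [seq (q, (i, j)) | q <- zip (codes_to i j) (map h (codes_to i j))].
    move=> _ /mapP[q + ->]; rewrite zipE => /mapP[t /hP[_ _ gh] ->] /=.
    by rewrite gh divgK.
  exact: realizes_cat E (realizes_flip E).
have [p pM pE] := matching 0 1 isT isT isT erefl.
have [q qM qE] := matching 0 2 isT isT isT erefl.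
have [r rM rE] := matching 1 2 isT isT isT erefl.
exact: (no_matchings tfG altN pM qM rM pE qE rE).
Qed.

End Atom.

Lemma fset_mulg_ge5 (B : {fset G}) :
  5 <= #|` B| -> #|` B| + 5 <= #|` fset_mulg B C|.
Proof.
move=> B5; rewrite leqNgt; apply/negP => BC.
(* An upper bound on |XC| avoids truncated subtraction; minimality of [m] turns it into an
   equality. *)
pose small k := `[< exists X : {fset G},
  5 <= #|` X| /\ #|` fset_mulg X C| <= #|` X| + k >].
have /ex_minnP[m /asboolP[X0 X0P] m_min] : exists k, small k.
  by exists 4; apply/asboolP; exists B; split=> //; lia.
have m4 : m <= 4 by apply: m_min; apply/asboolP; exists B; split=> //; lia.
pose atomic n := `[< exists X : {fset G},
  [/\ 5 <= #|` X|, #|` fset_mulg X C| <= #|` X| + m & #|` X| = n] >].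
have /ex_minnP[n /asboolP[A [A5 AC An]] n_min] : exists n, atomic n.
  by exists #|` X0|; apply/asboolP; exists X0; case: X0P.
have X_min (X : {fset G}) : 5 <= #|` X| -> #|` X| + m <= #|` fset_mulg X C|.
  (* For m = 0 the set XC contains X c_0; for m > 0 a smaller value contradicts minimality. *)
  move=> X5; case: (m) m_min => [|k] k_min.
    have <- : #|` [fset x * c 0 | x in X]%g%fset| = #|` X|.
      by rewrite card_imfset //; exact: mulIg.
    rewrite addn0; apply/fsubset_leq_card/fsubsetP => _
      /imfsetP[x xX ->]; rewrite mem_fset_mulg; apply/hasP; exists x => //.
    by apply/incidentP; exists 0.
  rewrite leqNgt; apply/negP => lt; suff /k_min : small k by rewrite ltnn.
  by apply/asboolP; exists X; split=> //; lia.
apply: (@atom_absurd A m) => // [|X /andP[X5 XA]].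
  by apply/eqP; rewrite eqn_leq AC X_min.
rewrite ltnNge; apply/negP => XC.
have : n <= #|` X| by apply: n_min; apply/asboolP; exists X.
by rewrite -An leqNgt XA.
Qed.

End Geometry.

(** * The Klein bottle relation *)

Section SignedPower.
Local Open Scope group_scope.
Variable G : groupType.
Implicit Types (u v g h : G) (n : nat) (s : bool).

Definition spow u s n : G := if s then u ^+ n else (u ^+ n)^-1.

Definition is_spow u g : Prop := exists s n, g = spow u s n.

Lemma is_spow1 u : is_spow u 1.
Proof. by exists true, 0%N. Qed.

Lemma is_spowV u g : is_spow u g -> is_spow u g^-1.
Proof.
by case=> -[] [n ->]; [exists false, n|exists true, n; rewrite /= invgK].
Qed.

Lemma is_spowMl u g : is_spow u g -> is_spow u (u * g).
Proof.
case=> -[] [n ->]; first by exists true, n.+1; rewrite /= expgS.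
case: n => [|n]; first by exists true, 1%N; rewrite /= invg1 mulg1.
by exists false, n; rewrite /= expgSr invgM mulVKg.
Qed.

Lemma is_spowVl u g : is_spow u g -> is_spow u (u^-1 * g).
Proof.
case=> -[] [n ->]; last by exists false, n.+1; rewrite /= expgSr invgM.
case: n => [|n]; first by exists false, 1%N; rewrite /= mulg1.
by exists true, n; rewrite /= expgS mulKg.
Qed.

Lemma is_spowM u g h : is_spow u g -> is_spow u h -> is_spow u (g * h).
Proof.
case=> s [n ->] uh; elim: n => [|n IH].
  by case: s; rewrite /= ?invg1 mul1g.
case: s IH => /= IH; first by rewrite expgS -mulgA; exact: is_spowMl.
by rewrite expgSr invgM -mulgA; exact: is_spowVl.
Qed.

End SignedPower.

Section KleinRelation.
Local Open Scope group_scope.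
Variables (G : groupType) (u v : G).
Hypotheses (tfG : torsion_free G) (u1 : u != 1) (uvu : u * v * u = v).

Lemma vuE : v * u = u^-1 * v.
Proof. by rewrite -[in RHS]uvu -mulgA mulKg. Qed.

Lemma v_spow s n : v * spow u s n = spow u (~~ s) n * v.
Proof.
have E k : v * u ^+ k = (u ^+ k)^-1 * v.
  elim: k => [|k IH]; first by rewrite invg1 mulg1 mul1g.
  by rewrite expgS mulgA vuE -mulgA IH mulgA -invgM -expgSr expgS.
case: s => //=; apply: (mulIg (u ^+ n)).
by rewrite mulgVK -mulgA E mulVKg.
Qed.

Lemma conjv_spow g : is_spow u (v^-1 * g * v) <-> is_spow u g.
Proof.
split=> -[s [n gE]]; exists (~~ s), n; last first.
  by rewrite gE -mulgA -[s in LHS]negbK -v_spow mulKg.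
by apply: (mulIg v); rewrite -v_spow -gE !mulgA mulgV mul1g.
Qed.

(** v^n is u^m or its inverse. It commutes with v, which inverts powers of u, so u^(2m) = 1 and m =
    0. If n > 0 then v = 1, and uvu = v becomes u^2 = 1. *)
Lemma spow_klein_eq1 s m t n :
  spow u s m * spow v t n = 1 -> m = 0%N /\ n = 0%N.
Proof.
move=> uv; have vn : v ^+ n = spow u (s (+) t) m.
  move: uv; case: s t => [] [] /= /mulg1_eq //.
  - by move=> /invg_inj.
  - by rewrite invgK.
  - by move=> /invg_inj.
have m0 : m = 0%N.
  have : spow u (~~ (s (+) t)) m = spow u (s (+) t) m.
    by apply: (mulIg v); rewrite -v_spow -vn -expgS expgSr.
  have [//|m_gt0] := posnP m; have u2 : u ^+ m * u ^+ m = 1 -> u = 1.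
    by rewrite -expgnDr => /tfG; apply; rewrite addn_gt0 m_gt0.
  case: (s (+) t) => /= E; case/eqP: u1; apply: u2.
    by rewrite -{1}E mulVg.
  by rewrite {2}E mulgV.
split=> //; have [//|n_gt0] := posnP n.
have v1 : v = 1.
  by apply: tfG n_gt0 _; rewrite vn m0; case: (_ (+) _); rewrite //= invg1.
case/eqP: u1; apply: (tfG (n := 2)) => //.
by rewrite expg2 -[LHS]mulg1 -{1}v1 -[in RHS]v1 -[in RHS]uvu v1 !mulg1.
Qed.

(** * Counting along rows, the cosets b <u> *)

Definition same_row (a b : G) : bool := `[< is_spow u (a^-1 * b) >].

Lemma same_row_refl a : same_row a a.
Proof. by apply/asboolP; rewrite mulVg; exact: is_spow1. Qed.

Lemma same_row_sym a b : same_row a b -> same_row b a.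
Proof.
by move=> /asboolP/is_spowV; rewrite invgM invgK => ba; apply/asboolP.
Qed.

Lemma same_row_trans a b d : same_row a b -> same_row b d -> same_row a d.
Proof.
move=> /asboolP ab /asboolP bd; apply/asboolP.
by rewrite -(mulVKg b d) mulgA; exact: is_spowM.
Qed.

Lemma same_row_u a : same_row a (a * u).
Proof. by apply/asboolP; rewrite mulKg; exists true, 1%N. Qed.

(** Conjugation by v preserves <u>, so right multiplication by v permutes the rows. *)
Lemma same_row_v a b : same_row (a * v) (b * v) = same_row a b.
Proof.
by apply/asbool_equiv_eq; rewrite invgM -!mulgA (mulgA a^-1) mulgA conjv_spow.
Qed.

Lemma same_row_vX a n : same_row a (a * v ^+ n) -> n = 0%N.
Proof.
move=> /asboolP; rewrite mulKg => -[s [m vE]].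
have /spow_klein_eq1[] // : spow u (~~ s) m * spow v true n = 1.
by rewrite /= vE; case: s {vE} => /=; rewrite ?mulVg ?mulgV.
Qed.

Definition ends (D : {fset G}) : {fset G} :=
  [fset b in D | ~~ has (same_row (b * v)) D]%fset.

Definition tops (D : {fset G}) : {fset G} :=
  [fset b in D | b * u \notin D]%fset.

Lemma mem_ends D b :
  (b \in ends D) = (b \in D) && ~~ has (same_row (b * v)) D.
Proof. by rewrite !inE. Qed.

Lemma mem_tops D b : (b \in tops D) = (b \in D) && (b * u \notin D).
Proof. by rewrite !inE. Qed.

Lemma seq_in_fset_repeats (D : {fset G}) (f : nat -> G) :
  (forall n, f n \in D) -> exists i j, (i < j)%N /\ f i = f j.
Proof.
move=> fD; apply: contrapT => f_inj.
have : (size [seq f n | n <- iota 0 (#|` D|).+1] <= #|` D|)%N.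
  apply: uniq_leq_size; last by move=> _ /mapP[n _ ->].
  rewrite map_inj_uniq ?iota_uniq // => i j fij; apply: contrapT => /eqP.
  by rewrite neq_ltn => /orP[] ij; apply: f_inj; [exists i, j|exists j, i].
by rewrite size_map size_iota ltnn.
Qed.

Lemma tops_neq0 D : D != fset0 -> tops D != fset0.
Proof.
case/fset0Pn=> b bD; apply/negP => /eqP T0.
have uD a : a \in D -> a * u \in D.
  by move=> aD; have := in_fset0 a; rewrite -T0 mem_tops aD /= => /negbFE.
have buD n : b * u ^+ n \in D.
  by elim: n => [|n IH]; rewrite ?mulg1 // expgSr mulgA uD.
have [i [j [ij]]] := seq_in_fset_repeats buD; move/mulgI.
rewrite -(subnKC (ltnW ij)) expgnDr -[LHS]mulg1 => /mulgI/esym uji.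
by case/eqP: u1; apply: tfG uji; rewrite subn_gt0.
Qed.

(** Otherwise v leads from each row of D to a row of D again; by finiteness a row repeats, against
    [same_row_vX]. *)
Lemma ends_neq0 D : D != fset0 -> ends D != fset0.
Proof.
case/fset0Pn=> b bD; apply/negP => /eqP T0.
have next a : exists d, a \in D -> (d \in D) && same_row (a * v) d.
  case: (boolP (a \in D)) => aD; last by exists a.
  have := in_fset0 a; rewrite -T0 mem_ends aD /= => /negbFE/hasP[d dD ad].
  by exists d; rewrite dD.
have [f fP] := boolp.choice next.
have itD n : iter n f b \in D by elim: n => //= n /fP/andP[].
have [i [j [ij fij]]] := seq_in_fset_repeats itD.
have row n k : same_row (iter n f b * v ^+ k) (iter (k + n) f b).
  elim: k => [|k IH]; first by rewrite mulg1 same_row_refl.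
  rewrite expgSr mulgA addSn; have /fP/andP[_] := itD (k + n)%N.
  by apply: same_row_trans; rewrite same_row_v.
have := row i (j - i)%N; rewrite subnK ?(ltnW ij) // -fij.
move=> /same_row_sym/same_row_vX; lia.
Qed.

(** [ends D] is a union of rows of D, so the tops of D split into those of [ends D], at least one,
    and those of the rest. *)
Lemma card_tops D :
  D != fset0 -> (#|` tops (D `\` ends D)%fset| < #|` tops D|)%N.
Proof.
move=> D0; have E0 : ends D != fset0 by exact: ends_neq0.
have end_row a b : a \in ends D -> b \in D -> same_row a b -> b \in ends D.
  rewrite !mem_ends => /andP[_ aD] bD ab; rewrite bD /=.
  apply: contraNN aD => /hasP[d dD bd]; apply/hasP; exists d => //.
  by apply: same_row_trans bd; rewrite same_row_v.
have sub : (tops (D `\` ends D)%fset `|` tops (ends D) `<=` tops D)%fset.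
  apply/fsubsetP => b; rewrite in_fsetU !mem_tops !in_fsetD.
  case/orP=> /andP[].
    move=> /andP[bE bD]; rewrite bD negb_and negbK /= => /orP[buE|//].
    apply: contraNN bE => buD; apply: end_row buE bD _.
    exact/same_row_sym/same_row_u.
  move=> bE buE; have bD : b \in D by move: bE; rewrite mem_ends => /andP[].
  rewrite bD /=; apply: contraNN buE => buD; apply: end_row bE buD _.
  exact: same_row_u.
have := fsubset_leq_card sub; rewrite cardfsU.
have -> : (tops (D `\` ends D) `&` tops (ends D))%fset = fset0.
  apply/fsetP => b; rewrite in_fsetI !mem_tops in_fsetD in_fset0.
  by case: (b \in ends D); rewrite //= andbF.
rewrite cardfs0 subn0; apply: leq_trans.
by rewrite -addn1 leq_add2l cardfs_gt0 tops_neq0.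
Qed.

Definition row_closed (B D : {fset G}) : Prop :=
  {subset D <= B} /\
  {in B, forall b, b \notin D -> {in D, forall d, ~~ same_row (b * v) d}}.

Lemma row_closedD B D : row_closed B D -> row_closed B (D `\` ends D)%fset.
Proof.
move=> [DB BD]; split=> [b|b bB]; first by rewrite in_fsetD => /andP[_ /DB].
rewrite in_fsetD negb_and negbK => bN d; rewrite in_fsetD => /andP[_ dD].
have [bD|bD] := boolP (b \in D); last exact: BD.
by move: bN; rewrite bD orbF mem_ends => /andP[_ /hasPn]; apply.
Qed.

(** Disjoint parts of the product are D, its tops times u, and [ends D] with the rest of B times v.
    The first two stay in rows meeting D; the third avoids these rows. *)
Lemma card_fset_mulg_rows (B D : {fset G}) : row_closed B D ->
  (#|` B| + #|` tops D| + #|` ends D| <=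
   #|` fset_mulg B [fset 1%g; u; v]%fset|)%N.
Proof.
move=> [DB BD]; pose F := ((B `\` D) `|` ends D)%fset.
pose Du := [fset b * u | b in tops D]%fset.
pose Fv := [fset b * v | b in F]%fset.
have rowF b d : b \in F -> d \in D -> ~~ same_row (b * v) d.
  rewrite in_fsetU in_fsetD mem_ends => /orP[/andP[bD bB]|/andP[_ /hasPn]].
    exact: BD.
  by apply.
have sub : ((D `|` Du) `|` Fv `<=` fset_mulg B [fset 1%g; u; v])%fset.
  apply/fsubsetP => x; rewrite !in_fsetU.
  case/orP=> [/orP[xD|/imfsetP[b + ->]]|/imfsetP[b + ->]].
  - apply/imfset2P; exists x; first exact: DB.
    by exists 1; rewrite ?mulg1 // !inE eqxx.
  - rewrite mem_tops => /andP[/DB bB _].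
    by apply/imfset2P; exists b => //; exists u; rewrite // !inE eqxx orbT.
  - move=> bF; apply/imfset2P; exists b; last first.
      by exists v; rewrite // !inE eqxx orbT.
    move: bF; rewrite in_fsetU in_fsetD mem_ends.
    by case/orP=> /andP[] => [_|/DB].
have := fsubset_leq_card sub; rewrite !cardfsU.
have -> : (D `&` Du)%fset = fset0.
  apply/fsetP => x; rewrite in_fsetI in_fset0; apply/andP => -[xD /imfsetP[b]].
  by rewrite mem_tops => /andP[_ buD] xE; rewrite xE (negbTE buD) in xD.
have -> : ((D `|` Du) `&` Fv)%fset = fset0.
  apply/fsetP => x; rewrite in_fsetI in_fset0.
  apply/andP => -[xDu /imfsetP[b bF xE]].
  have [d dD xd] : exists2 d, d \in D & same_row x d.
    move: xDu; rewrite in_fsetU => /orP[xD|/imfsetP[d]].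
      by exists x; rewrite ?same_row_refl.
    rewrite mem_tops => /andP[dD _] ->; exists d => //.
    exact/same_row_sym/same_row_u.
  by have := rowF b d bF dD; rewrite -xE xd.
have -> : #|` Du| = #|` tops D| by rewrite card_imfset //; exact: mulIg.
have -> : #|` Fv| = #|` F| by rewrite card_imfset //; exact: mulIg.
rewrite !cardfs0 !subn0 /F cardfsU.
have -> : ((B `\` D) `&` ends D)%fset = fset0.
  apply/fsetP => x; rewrite in_fsetI in_fsetD mem_ends in_fset0.
  by case: (x \in D); rewrite //= andbF.
have DsB : (D `<=` B)%fset by exact/fsubsetP.
by rewrite cardfs0 subn0 cardfsDS //; have := fsubset_leq_card DsB; lia.
Qed.

(* Remove from B the rows that v maps off B, and repeat. If |BC| < |B| + 5, then
   nothing is left after three rounds, which remove at most 1, 2 and 3 elements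
   when all three are needed. *)
Lemma klein_fset_mulg (B : {fset G}) : (7 <= #|` B|)%N ->
  (#|` B| + 5 <= #|` fset_mulg B [fset 1%g; u; v]%fset|)%N.
Proof.
move=> B7; rewrite leqNgt; apply/negP => small.
have step D : row_closed B D -> let D' := (D `\` ends D)%fset in
    [/\ row_closed B D', (#|` D| = #|` ends D| + #|` D'|)%N,
        (#|` tops D| + #|` ends D| <= 4)%N &
        (0 < #|` D| -> 0 < #|` ends D| /\ #|` tops D'| < #|` tops D|)%N].
  move=> BD D'; split.
  - exact: row_closedD.
  - have ED : (ends D `<=` D)%fset.
      by apply/fsubsetP => x; rewrite mem_ends => /andP[].
    by rewrite cardfsDS // subnKC // fsubset_leq_card.
  - by have := card_fset_mulg_rows BD; lia.
  - by rewrite !cardfs_gt0 => D0; split; [exact: ends_neq0|exact: card_tops].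
have BB : row_closed B B by split=> // b bB; rewrite bB.
have [B1 card0 le0 pos0] := step _ BB; have [B2 card1 le1 pos1] := step _ B1.
have [B3 card2 le2 pos2] := step _ B2; have [_ card3 le3 pos3] := step _ B3.
(* Tops strictly decrease while elements remain, and tops plus ends are at most 4. A fourth round
   would leave no ends in the first; three rounds remove at most 1 + 2 + 3 = 6 elements. *)
lia.
Qed.

End KleinRelation.

(** * The Klein bottle group as the subgroup generated by u and v *)

Section KleinIsomorphism.
Local Open Scope group_scope.
Local Open Scope classical_set_scope.

(** Letters are added on the left; V passes a power of U by inverting it. *)
Lemma eval_klein_form (P : groupType) (U V : P) (w : seq (bool * bool)) :
  U * V * U = V -> exists s m t n,
  eval (fun x : bool => if x then U else V) w = spow U s m * spow V t n.
Proof.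
move=> UVU; suff [h [k [[s [m ->]] [t [n ->]] ->]]] : exists h k,
    [/\ is_spow U h, is_spow V k
      & eval (fun x : bool => if x then U else V) w = h * k].
  by exists s, m, t, n.
elim: w => [|[x b] w [h [k [hU kV wE]]]].
  by exists 1, 1; split; rewrite ?mulg1; [exact: is_spow1|exact: is_spow1|].
rewrite /= wE /eval_letter; case: x b => [] [] /=.
- by exists (U * h), k; split; rewrite ?mulgA //; exact: is_spowMl.
- by exists (U^-1 * h), k; split; rewrite ?mulgA //; exact: is_spowVl.
- case: hU => s [m ->]; exists (spow U (~~ s) m), (V * k).
  by split; [exists (~~ s), m|exact: is_spowMl|rewrite !mulgA -(v_spow UVU)].
- case: hU => s [m ->]; exists (spow U (~~ s) m), (V^-1 * k).
  split; [by exists (~~ s), m|exact: is_spowVl|].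
  apply: (mulgI V); rewrite mulVKg !mulgA (v_spow UVU) negbK.
  by rewrite -(mulgA _ V) mulgV mulg1.
Qed.

Lemma subgroup_setP (P : groupType) (H : set P) :
  subgroup_set H <-> H 1 /\ forall a b, H a -> H b -> H (a / b).
Proof.
split=> -[H1 HB]; split; first exact: set_mem H1.
- by move=> a b /mem_set aH /mem_set bH; apply: set_mem; exact: HB.
- exact: mem_set.
- by move=> a b /set_mem aH /set_mem bH; apply/mem_set/HB.
Qed.

Variables (G : groupType) (u v : G).
Hypotheses (tfG : torsion_free G) (u1 : u != 1) (uvu : u * v * u = v).

Let letter (x : bool) : G := if x then u else v.

Lemma eval_klein_cong w w' :
  pres_cong klein_rel w w' -> eval letter w = eval letter w'.
Proof.
elim=> //.
- by move=> {}w {}w' w2 _ -> _ ->.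
- by move=> w1 w1' w2 w2' _ E1 _ E2; rewrite !eval_cat E1 E2.
- by move=> x b; rewrite /= mulg1 (eval_letterV letter (x, b)) mulgV.
- by move=> _ _ [-> ->]; rewrite /= /eval_letter /= !mulg1 mulgA.
Qed.

(** The relation is an explicit argument so that the morphism structure, which depends on it,
    attaches to [klein_hom uvu]. *)
Definition klein_hom of u * v * u = v :=
  fun a : klein_bottle_group => eval letter (repr a).

Lemma klein_hom_pi w : klein_hom uvu (pres_pi klein_rel w) = eval letter w.
Proof. exact/eval_klein_cong/pres_repr_cong. Qed.

Lemma klein_hom_monoid_morphism : monoid_morphism (klein_hom uvu).
Proof.
split; first exact: (klein_hom_pi [::]).
by move=> a b; rewrite [LHS]klein_hom_pi eval_cat.
Qed.

HB.instance Definition _ := isUMagmaMorphism.Build klein_bottle_group G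
  (klein_hom uvu) klein_hom_monoid_morphism.

Let kgen (b : bool) : klein_bottle_group := pres_pi klein_rel [:: (b, true)].

Lemma klein_rel_gen : kgen true * kgen false * kgen true = kgen false.
Proof.
have xy : kgen true * kgen false =
          pres_pi klein_rel [:: (true, true); (false, true)].
  exact: pres_mulE.
rewrite xy; apply: etrans (pres_mulE _ _ _) _.
exact/pres_piP/pres_cong_rel.
Qed.

Lemma eval_kgen w : eval kgen w = pres_pi klein_rel w.
Proof.
elim: w => //= -[x b] w ->.
have -> : eval_letter kgen (x, b) = pres_pi klein_rel [:: (x, b)].
  by case: b => //; exact: (pres_invE klein_rel [:: (x, true)]).
exact: pres_mulE.
Qed.

(** A kernel element has a normal form x^a y^b with image u^a v^b, which is 1 only for a = b = 0. *)
Lemma klein_hom_inj : injective (klein_hom uvu).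
Proof.
suff ker a : klein_hom uvu a = 1 -> a = 1 by exact: (gmulf_inj ker).
have [s [m [t [n]]]] := eval_klein_form (repr a) klein_rel_gen.
have kE : (fun x : bool => if x then kgen true else kgen false) =1 kgen by case.
rewrite (_ : (fun x : bool => _) = kgen); last exact/funext.
rewrite eval_kgen pres_repr => ->.
have homX r k g : klein_hom uvu (spow g r k) = spow (klein_hom uvu g) r k.
  by case: r; [exact: gmulfXn|exact: gmulfXVn].
rewrite klein_hom_monoid_morphism.2 !homX !klein_hom_pi /= !mulg1.
move=> /(spow_klein_eq1 tfG u1 uvu)[-> ->].
by case: s t => [] []; rewrite /= ?invg1 mulg1.
Qed.

Lemma klein_isog (H : set G) : subgroup_set H -> H u -> H v ->
  (forall K : set G, subgroup_set K -> K u -> K v -> H `<=` K) ->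
  subgroup_isog klein_bottle_group H.
Proof.
move=> /subgroup_setP[H1 HB] Hu Hv Hmin.
exists (klein_hom uvu : {multiplicative _ -> _}); split.
- move=> a _; rewrite -[a]pres_repr /= klein_hom_pi.
  elim: (repr a) => [|[x b] w IH] //=.
  have HV g : H g -> H g^-1 by rewrite -div1g; exact: HB.
  have Hl : H (letter x) by case: x.
  case: b => /=; last by rewrite -[eval _ _]invgK; apply: HB; exact: HV.
  by rewrite -[eval _ _]invgK; apply: HB => //; exact: HV.
- by move=> a b _ _ /klein_hom_inj.
apply: Hmin.
- apply/subgroup_setP; split; first by exists 1 => //; exact: gmulf1.
  move=> _ _ [a _ <-] [b _ <-].
  by exists (a / b) => //; exact: gmulfF.
- by exists (kgen true) => //; apply: etrans (klein_hom_pi _) _; exact: mulg1.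
- by exists (kgen false) => //; apply: etrans (klein_hom_pi _) _; exact: mulg1.
Qed.

End KleinIsomorphism.

(** * Short alternating relators *)

Definition letters : seq (nat * bool) :=
  [seq (i, b) | i <- iota 0 3, b <- [:: true; false]].

Fixpoint alt_paths n a : seq (seq (nat * bool)) :=
  if n isn't n'.+1 then [:: [::]] else
  flatten [seq [seq b :: w | w <- alt_paths n' b]
            | b <- letters & alternates a b].

Lemma mem_letters l : l.1 < 3 -> l \in letters.
Proof. by case: l => [[|[|[|]]] []]. Qed.

Lemma mem_alt_paths a w : all (fun l => l.1 < 3) w -> path alternates a w ->
  w \in alt_paths (size w) a.
Proof.
elim: w a => // b w IH a /andP[b3 w3] /andP[ab bw].
rewrite -[alt_paths _ _]/(flatten [seq [seq d :: u | u <- alt_paths (size w) d]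
  | d <- letters & alternates a d]).
apply/flatten_mapP; exists b; first by rewrite mem_filter ab mem_letters.
by apply/mapP; exists w => //; exact: IH.
Qed.

(* c_i c_j^-1 c_k c_j^-1 c_i c_k^-1; in terms of x = c_i c_j^-1 and
   y = c_k c_j^-1 it is the relator x y x y^-1 of the Klein bottle group. *)
Definition klein_word i j k : seq (nat * bool) :=
  [:: (i, true); (j, false); (k, true); (j, false); (i, true); (k, false)].

Definition is_klein w : bool :=
  has (fun s => uniq s &&
    (klein_word (nth 0 s 0) (nth 0 s 1) (nth 0 s 2) \in conj_rots w)) triples.

(* For c_0 = 1 this is the commutator of c_1^-1 and c_2. *)
Definition commutator_word : seq (nat * bool) :=
  [:: (0, true); (1, false); (2, true); (0, false); (1, true); (2, false)].

(** Relators excluded by hypothesis: length 2 identifies two elements of C, the commutator makes <C>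
    abelian. *)
Definition degenerate w : bool :=
  (size w == 2) && short_alt w || (commutator_word \in conj_rots w).

(** [n] counts the letters after the first, so the lengths are 1 to 6. *)
Definition alt_words : seq (seq (nat * bool)) :=
  flatten [seq [seq a :: w | n <- iota 0 6, w <- alt_paths n a] | a <- letters].

Lemma short_alt_dichotomy :
  all (fun w => if short_alt w
    then if is_klein w then true else refute degenerate [:: w] else true)
  alt_words.
Proof. by vm_compute. Qed.

Lemma short_alt_klein (G : groupType) (c : nat -> G) w : torsion_free G ->
  (forall i j, i < 3 -> j < 3 -> c i = c j -> i = j) ->
  eval c commutator_word <> 1%g -> short_alt w -> eval c w = 1%g ->
  exists i j k, [/\ i < 3, j < 3, k < 3, uniq [:: i; j; k]
                  & eval c (klein_word i j k) = 1%g].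
Proof.
move=> tfG c_inj comN salt w1.
have degN u : degenerate u -> eval c u <> 1%g.
  case/orP=> [|comu u1]; last by apply: comN; exact: relator_conj_rots comu u1.
  case: u => [|[i b] [|[j d] []]] // /andP[_ /and3P[_ /and3P[/= i3 j3 _]]].
  case/andP=> /andP[/= ij bd] _; move: bd; rewrite /eval_letter.
  case: b d => [] [] //= _; rewrite mulg1.
    by move/divg1_eq/c_inj => /(_ i3 j3); apply/eqP.
  by move/mulg1_eq; rewrite invgK => /c_inj => /(_ i3 j3); apply/eqP.
have wW : w \in alt_words.
  case/and3P: (salt); case: w {salt w1} => // a w wn /andP[a3 w3].
  rewrite [cycle _ _]/= rcons_path => /andP[aw _]; apply/flatten_mapP; exists a.
    exact: mem_letters.
  apply/allpairsPdep; exists (size w), w; split=> //; last exact: mem_alt_paths.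
  by rewrite mem_iota.
have := elimT allP short_alt_dichotomy w wW; cbv beta; rewrite salt.
case: ifPn => [/hasP[s sT /andP[us kw]] _|_ ref]; last first.
  suff: ~~ refute degenerate [:: w] by rewrite ref.
  by apply: (refuteN tfG degN) => u; rewrite inE => /eqP->.
exists (nth 0 s 0), (nth 0 s 1), (nth 0 s 2).
have := relator_conj_rots kw w1.
case/allpairsP: sT us => [[i t] [+ /allpairsP[[j k] [+ + ->]] ->]] /=.
by rewrite !mem_iota.
Qed.

(** * Generated subgroups *)

Section Generated.
Local Open Scope group_scope.
Local Open Scope classical_set_scope.
Variables (G : groupType) (A : set G).

Lemma generated_subgroup : subgroup_set (generated A).
Proof.
apply/subgroup_setP; split=> [K [/subgroup_setP[]//]|a b aA bA K KA].
by have /subgroup_setP[_ KB] := KA.1; apply: KB; [exact: aA|exact: bA].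
Qed.

Lemma sub_generated : A `<=` generated A.
Proof. exact: sub_smallest. Qed.

(** Centralizers are subgroups: <A> centralizes A, hence A centralizes <A>, hence <A> centralizes
    itself. *)
Lemma generated_abelian : {in A &, forall x y, commute x y} ->
  abelian_set (generated A).
Proof.
have centr (S : set G) : subgroup_set [set g | forall s, S s -> commute g s].
  apply/subgroup_setP; split=> [s _|g h gS hS s Ss].
    exact/commute_sym/commute1.
  by apply/commute_sym/commuteM; [|apply/commuteV]; apply/commute_sym; auto.
move=> comA x y /set_mem xA /set_mem yA.
suff gA : generated A `<=` [set g | forall s, generated A s -> commute g s].
  exact: gA xA y yA.
apply: smallest_sub => // a aA s sA; apply/commute_sym; move: s sA.
have : generated A `<=` [set g | forall s, A s -> commute g s].
  by apply: smallest_sub => // g gA' s sA; apply: comA; exact: mem_set.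
by move=> gA s sA; exact: gA.
Qed.

End Generated.

Lemma fset3_with1 (G : groupType) (C : {fset G}) :
  (1%g : G) \in C -> #|` C|%fset = 3 ->
  exists x y, uniq [:: 1%g; x; y] /\ C =i [:: 1%g; x; y].
Proof.
move=> C1 C3; have : size (C `\ 1%g)%fset = 2.
  by have := cardfsD1 1%g C; rewrite C1 C3 => -[].
case E : (enum_fset (C `\ 1%g)%fset) => [|x [|y []]] // _; exists x, y.
have CE z : (z \in (C `\ 1%g)%fset) = (z \in [:: x; y]) by rewrite -E.
split; last first.
  move=> z; rewrite in_cons -CE in_fsetD1.
  by case: eqP => [->|]; rewrite ?C1.
have := fset_uniq (C `\ 1%g)%fset; rewrite E => uxy.
by rewrite cons_uniq uxy andbT -CE in_fsetD1 eqxx.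
Qed.

(** * From a Klein relator to <C> *)

Section Main.
Local Open Scope group_scope.
Variables (G : groupType) (c : nat -> G) (C : {fset G}).
Hypotheses (tfG : torsion_free G) (CE : C =i [:: c 0%N; c 1%N; c 2%N]).
Hypothesis c0 : c 0%N = 1.
Hypothesis c_inj : forall i j, (i < 3)%N -> (j < 3)%N -> c i = c j -> i = j.
Variables (i j k : nat).
Hypotheses (i3 : (i < 3)%N) (j3 : (j < 3)%N) (k3 : (k < 3)%N).
Hypothesis ijk : uniq [:: i; j; k].
Hypothesis klein1 : eval c (klein_word i j k) = 1.

Let u := c i / c j.
Let v := c k / c j.

Lemma klein_word_relation : u * v * u = v.
Proof.
apply: divg1_eq; rewrite /u /v -klein1 /klein_word /= /eval_letter /= mulg1.
by rewrite invgF !mulgA mulgVK.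
Qed.

Lemma klein_word_neq1 : u != 1.
Proof.
apply/eqP => /divg1_eq/c_inj => /(_ i3 j3) ij.
by move: ijk; rewrite ij /= inE eqxx.
Qed.

Lemma mem_ijk l : (l < 3)%N -> l \in [:: i; j; k].
Proof.
move=> l3; have sub : {subset [:: i; j; k] <= iota 0 3}.
  by apply/allP; rewrite /all !mem_iota i3 j3 k3.
by have [_ ->] := uniq_min_size ijk sub (leqnn 3); rewrite mem_iota.
Qed.

Lemma c_in_C l : (l < 3)%N -> c l \in C.
Proof. by case: l => [|[|[|]]]; rewrite // CE !inE eqxx ?orbT. Qed.

Lemma mem_klein_triple d : (d \in [fset 1; u; v]%fset) = (d * c j \in C).
Proof.
rewrite !inE; apply/idP/idP => [/orP[/orP[]|] /eqP->|].
- by rewrite mul1g c_in_C.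
- by rewrite divgK c_in_C.
- by rewrite divgK c_in_C.
have [l l3] : exists2 l, (l < 3)%N & d * c j \in C -> d * c j = c l.
  have [dC|] := boolP (d * c j \in C); last by exists 0%N.
  by move: dC; rewrite CE !inE => /or3P[] /eqP dE;
    [exists 0%N|exists 1%N|exists 2%N].
move=> dE /dE {}dE; have -> : d = c l / c j by rewrite -dE mulgK.
move/mem_ijk: l3; rewrite !inE => /or3P[] /eqP->; rewrite ?eqxx ?orbT //.
by rewrite mulgV eqxx.
Qed.

Lemma card_fset_mulg_translate (B : {fset G}) :
  #|` fset_mulg B [fset 1; u; v]%fset| = #|` fset_mulg B C|.
Proof.
rewrite (_ : fset_mulg B _ = [fset z / c j | z in fset_mulg B C]%fset).
  by rewrite card_imfset // => x y /mulIg.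
apply/fsetP => z.
apply/imfset2P/imfsetP => [[b bB [d dD ->]]|[w /imfset2P[b bB [e eC ->]] ->]].
  exists (b * (d * c j)); last by rewrite mulgA mulgK.
  apply/imfset2P; exists b => //; exists (d * c j) => //.
  by rewrite -mem_klein_triple.
exists b => //; exists (e / c j); last by rewrite mulgA.
by rewrite mem_klein_triple divgK.
Qed.

Lemma klein_generated :
  subgroup_isog klein_bottle_group (generated [set` C]%classic).
Proof.
have genC := @sub_generated _ [set` C]%classic.
have genD := generated_subgroup [set` C]%classic.
have /subgroup_setP[_ genB] := genD.
apply: (klein_isog tfG klein_word_neq1 klein_word_relation) => //.
- by apply: genB; apply: genC; exact: c_in_C.
- by apply: genB; apply: genC; exact: c_in_C.
move=> K Kgrp Ku Kv; apply: smallest_sub => // z /=; rewrite CE.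
have /subgroup_setP[K1 KB] := Kgrp.
have KV g : K g -> K g^-1 by rewrite -div1g; exact: KB.
have KM g h : K g -> K h -> K (g * h).
  by move=> Kg Kh; rewrite -(invgK h); apply: KB => //; exact: KV.
(* One of c_i, c_j, c_k is c_0 = 1. Unless it is c_j itself, u or v equals c_j^-1. *)
have Kcj : K (c j).
  have := mem_ijk (isT : (0 < 3)%N); rewrite !inE => /or3P[] /eqP E.
  - by rewrite -[c j]invgK -[(c j)^-1]div1g -c0 E; exact: KV.
  - by rewrite -E c0.
  - by rewrite -[c j]invgK -[(c j)^-1]div1g -c0 E; exact: KV.
have Kc l : (l < 3)%N -> K (c l).
  move=> /mem_ijk; rewrite !inE => /or3P[] /eqP -> //.
  - by rewrite -(divgK (c j) (c i)); exact: KM.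
  - by rewrite -(divgK (c j) (c k)); exact: KM.
by rewrite !inE => /or3P[] /eqP->; exact: Kc.
Qed.

End Main.

Theorem theorem1p2 (G : groupType) (tfG : torsion_free G) (C : {fset G})
    (C1 : (1%g : G) \in C) (C3 : #|` C|%fset = 3)
    (nabC : ~ abelian_set (generated [set` C]%classic)) :
  (forall B : {fset G}, 7 <= #|` B|%fset ->
     #|` B|%fset + 5 <= #|` fset_mulg B C|%fset) /\
  (~ subgroup_isog klein_bottle_group (generated [set` C]%classic) ->
   forall B : {fset G}, 5 <= #|` B|%fset ->
     #|` B|%fset + 5 <= #|` fset_mulg B C|%fset).
Proof.
have [x [y [xy CE]]] := fset3_with1 C1 C3.
pose c := nth 1%g [:: 1%g; x; y].
have c_inj i j : i < 3 -> j < 3 -> c i = c j -> i = j.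
  move=> i3 j3 cij; apply/eqP; rewrite -(nth_uniq (s := [:: 1%g; x; y]) 1%g) //.
  exact/eqP.
have comN : eval c commutator_word <> 1%g.
  rewrite /= /eval_letter /= invg1 !mul1g mulg1 => yx; apply: nabC.
  have xyC : commute y x.
    apply: (mulgI x^-1%g); apply: (mulIg y^-1%g).
    by rewrite mulKg mulgV -!mulgA.
  apply: generated_abelian => a b; rewrite !inE /= !CE !inE.
  by move=> /or3P[] /eqP-> /or3P[] /eqP->; rewrite /commute ?mulg1 ?mul1g.
(* Without short alternating relators the bound holds from 5 elements on. Otherwise a Klein word is
   a relator, which contradicts the hypothesis of the second claim and leaves the bound from 7
   on. *)
have [noshort|] := pselect (forall w, short_alt w -> eval c w <> 1%g).
  have main := fset_mulg_ge5 tfG CE noshort.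
  by split=> [B B7|_]; [apply: main; apply: leq_trans B7|].
move=> /existsNP[w /not_implyP[salt /contrapT w1]].
have [i [j [k [i3 j3 k3 ijk kw]]]] := short_alt_klein tfG c_inj comN salt w1.
have isog := klein_generated tfG (c := c) CE erefl c_inj i3 j3 k3 ijk kw.
split; last by move=> /(_ isog).
move=> B B7; rewrite -(card_fset_mulg_translate (c := c) CE i3 j3 k3 ijk).
apply: klein_fset_mulg => //.
  exact: (klein_word_neq1 c_inj i3 j3 ijk).
exact: klein_word_relation kw.
Qed.
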